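(* The Bézout invariants distinguish all the naive homotopy classes of rational functions: the map $$ \Big( \coprod_{n\geq 0} (\pi_0^{\mathrm{N}} \mathcal{F}_n)(k) , \oplus^{\mathrm{N}} \Big) \xrightarrow{\coprod_{n\geq0} \pi_0^{\mathrm{N}} \mathrm{B\acute{e}z}_n} \Big(\coprod_{n\geq 0} (\pi_0^{\mathrm{N}} \mathcal{S}_n)(k), \oplus \Big)$$ is an isomorphism of graded monoids.
   Context: Let $k$ be a field. For $n\geq 0$, $\mathcal{F}_n$ is the scheme of pointed degree $n$ rational functions: for a ring $R$, an $R$-point is a pair $(A,B)$ of polynomials in $R[X]$, written $\frac{A}{B}$, with $A$ monic of degree $n$, $\deg B<n$ and $\mathrm{res}_{n,n}(A,B)\in R^\times$; equivalently there is a unique Bézout relation $AU+BV=1$ with $\deg U\leq n-2$, $\deg V\leq n-1$. The monoid law $\oplus^{\mathrm{N}}$ on $\coprod_n \mathcal{F}_n$: given $\frac{A_i}{B_i}\in\mathcal{F}_{n_i}(R)$ with Bézout relations $A_iU_i+B_iV_i=1$, define $\begin{bmatrix}A_3 & -V_3\\ B_3 & U_3\end{bmatrix} := \begin{bmatrix}A_1 & -V_1\\ B_1 & U_1\end{bmatrix}\begin{bmatrix}A_2 & -V_2\\ B_2 & U_2\end{bmatrix}$ and set $\frac{A_1}{B_1}\oplus^{\mathrm{N}}\frac{A_2}{B_2}:=\frac{A_3}{B_3}\in\mathcal{F}_{n_1+n_2}(R)$. $\mathcal{S}_n$ is the scheme of non-degenerate $n\times n$ symmetric matrices, with monoid law the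 block (orthogonal) sum $\oplus$. The Bézout morphism $\mathrm{B\acute{e}z}_n:\mathcal{F}_n\to\mathcal{S}_n$ sends $\frac{A}{B}$ to the symmetric matrix $[c_{p,q}]_{1\leq p,q\leq n}$ where $\frac{A(X)B(Y)-A(Y)B(X)}{X-Y}=\sum_{p,q} c_{p,q}X^{p-1}Y^{q-1}$. For a functor $\mathcal{G}$ from $k$-algebras to sets, $(\pi_0^{\mathrm{N}}\mathcal{G})(R)$ is the coequalizer of the two maps $\mathcal{G}(R[T])\rightrightarrows\mathcal{G}(R)$ given by evaluation at $T=0$ and $T=1$ (naive homotopy classes); morphisms induce maps on $\pi_0^{\mathrm{N}}$ and $\oplus^{\mathrm{N}}$, $\oplus$ descend to these sets. Note $\coprod_n(\pi_0^{\mathrm{N}}\mathcal{F}_n)(k)$ is the set of pointed naive homotopy classes of pointed endomorphisms of $\mathbf{P}^1$ over $k$ (base point $\infty=[1:0]$). *)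

(* Defs.v *)
From HB Require Import structures.
From mathcomp Require Import all_boot all_order all_algebra.
From Stdlib Require Import Relations ClassicalEpsilon.
Set Implicit Arguments. Unset Strict Implicit. Unset Printing Implicit Defensive.
Import GRing.Theory.
Local Open Scope ring_scope.

(* Sylvester matrix with formal degrees (m, n): n rows of shifts of p
   (formal degree m), then m rows of shifts of q (formal degree n). *)
Definition sylvester_mx (R : comNzRingType) (m n : nat) (p q : {poly R})
  : 'M[R]_(n + m) :=
  col_mx (\matrix_(i < n) (poly_rV (p * 'X^i) : 'rV[R]_(n + m)))
         (\matrix_(i < m) (poly_rV (q * 'X^i) : 'rV[R]_(n + m))).

Definition res_mn (R : comNzRingType) (m n : nat) (p q : {poly R}) : R :=
  \det (sylvester_mx m n p q).

Definition ratfun_pt (R : comUnitRingType) (n : nat) (A B : {poly R}) : Prop :=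
  [/\ A \is monic, size A = n.+1, (size B <= n)%N
    & res_mn n n A B \is a GRing.unit].

(* Bezout relation AU + BV = 1 with deg U <= n-2, deg V <= n-1
   (for n = 0 the relation is the trivial one U = 1, V = 0). *)
Definition bezout_rel (R : comNzRingType) (n : nat) (A B U V : {poly R}) : Prop :=
  [/\ A * U + B * V = 1,
      (size U <= (if n is 0 then 1 else n.-1))%N
    & (size V <= n)%N].

(* the (unique) Bezout coefficients (U, V) *)
Definition bez_UV (R : comNzRingType) (n : nat) (A B : {poly R})
  : {poly R} * {poly R} :=
  epsilon (inhabits (0, 0)) (fun uv => bezout_rel n A B uv.1 uv.2).

(* monoid law  A1/B1 (+)^N A2/B2  (A1/B1 of degree n1) : first column of
   [A1 -V1; B1 U1] * [A2 -V2; B2 U2] *)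
Definition oplusN (R : comNzRingType) (n1 : nat) (A1 B1 A2 B2 : {poly R})
  : {poly R} * {poly R} :=
  let UV1 := bez_UV n1 A1 B1 in
  (A1 * A2 - UV1.2 * B2, B1 * A2 + UV1.1 * B2).

Definition symnd_pt (R : comUnitRingType) (n : nat) (M : 'M[R]_n) : Prop :=
  M^T = M /\ \det M \is a GRing.unit.

Definition osum (R : comNzRingType) (n1 n2 : nat) (M1 : 'M[R]_n1) (M2 : 'M[R]_n2)
  : 'M[R]_(n1 + n2) := block_mx M1 0 0 M2.

(* In {poly {poly k}}, the outer variable is X and the inner one is Y.
   bez_quot A B = (A(X)B(Y) - A(Y)B(X)) / (X - Y). *)
Definition bez_quot (k : fieldType) (A B : {poly k}) : {poly {poly k}} :=
  ((map_poly polyC A) * (B%:P) - (A%:P) * (map_poly polyC B))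
    %/ ('X - ('X : {poly k})%:P).

(* c_{p,q} = coefficient of X^{p-1} Y^{q-1} (indices here start at 0) *)
Definition Bez_mx (k : fieldType) (n : nat) (A B : {poly k}) : 'M[k]_n :=
  \matrix_(i < n, j < n) ((bez_quot A B)`_i)`_j.

Definition evT (k : fieldType) (t : k) (p : {poly k}) : k := p.[t].

Definition htpF (k : fieldType) (n : nat) (x y : {poly k} * {poly k}) : Prop :=
  exists H : {poly {poly k}} * {poly {poly k}},
    [/\ ratfun_pt n H.1 H.2,
        (map_poly (evT 0) H.1, map_poly (evT 0) H.2) = x
      & (map_poly (evT 1) H.1, map_poly (evT 1) H.2) = y].

Definition htpS (k : fieldType) (n : nat) (x y : 'M[k]_n) : Prop :=
  exists H : 'M[{poly k}]_n,
    [/\ symnd_pt H, map_mx (evT 0) H = x & map_mx (evT 1) H = y].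

(* coequalizer of G(k[T]) ⇉ G(k) : quotient by the equivalence relation
   generated by the elementary homotopies *)
Definition naiveF (k : fieldType) (n : nat) := clos_refl_sym_trans _ (@htpF k n).
Definition naiveS (k : fieldType) (n : nat) := clos_refl_sym_trans _ (@htpS k n).

Arguments sylvester_mx {R} m n p q.
Arguments res_mn {R} m n p q.
Arguments ratfun_pt {R} n A B.
Arguments bezout_rel {R} n A B U V.
Arguments bez_UV {R} n A B.
Arguments oplusN {R} n1 A1 B1 A2 B2.
Arguments symnd_pt {R n} M.
Arguments osum {R n1 n2} M1 M2.
Arguments Bez_mx {k} n A B.
Arguments htpF {k} n x y.
Arguments htpS {k} n x y.
Arguments naiveF {k} n.
Arguments naiveS {k} n.

(* Main.v *)
Require Import Defs.
From HB Require Import structures.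
From mathcomp Require Import all_boot all_order all_algebra.
From mathcomp Require Import ring zify.
From Stdlib Require Import Relations ClassicalEpsilon.
Set Implicit Arguments. Unset Strict Implicit. Unset Printing Implicit Defensive.
Import GRing.Theory.
Local Open Scope ring_scope.

(** A Bezout relation over k[T] shows that (+)^N and the Bezout map respect naive
    homotopies. By the Euclidean algorithm, with the remainders deformed, every pointed
    rational function is homotopic to a sum X/u_1 (+) ... (+) X/u_n, whose Bezout form is
    <u_1> + ... + <u_n> up to a matrix of determinant 1; since SL_n(k) is connected
    through naive homotopies, this settles additivity. It also gives surjectivity: a
    form splits into lines <u> and planes [[0, c], [c, p]], and such a plane can be
    deformed to p = 1, where it is <1> + <-c^2>.

    For injectivity, reduction theory over k[T] (Hermite's bound on the minimum of a
    form by its discriminant) splits every unimodular symmetric form over k[T], up to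
    SL_n(k[T]), into constant lines <u> and metabolic planes [[0, c], [c, p]] with c
    constant. Reading a line as X/u and such a plane as X/1 (+) X/(-c^2), the
    class attached to a form does not change along a homotopy, provided that it does not
    depend on the splitting. That independence is a characteristic-free form of Witt's
    chain equivalence: it reduces to forms of rank 2, for which the Bezout map has
    an explicit section over every ring. Alternating forms, which occur only in
    characteristic 2, split into planes with p = 0 and are classified by their
    determinant. *)

(** * Bezout relations and resultants *)

(** A unit of k[T] is a constant, so a naive homotopy of forms preserves the determinant itself and
    not only its class modulo squares. This is why every change of basis has determinant 1, and why
    signs and squares are tracked throughout. The bookkeeping is done with sequences of nonzero
    scalars: [sumF] turns a sequence into a rational function, [dec] says that it splits a form, and
    the relation [leqs] is both sound for homotopies of functions and complete for the splittings of
    one form. Its basic relations change two neighbouring terms, which is where rank 2 enters: a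
    path of forms of rank 2 lifts to a path of functions, to which a fixed function may be added.
    The entry p of a plane is the obstacle. Replacing the second vector f by f + y e changes p by 2
    c y, which is nothing in characteristic 2, and over k[T] the polynomial p may vanish at some
    values of T only, so that the plane cannot be diagonalised along the whole homotopy. Forgetting
    p is harmless because the determinant - c^2 of the plane does not involve it. *)

Lemma mul_sylvester_mx (R : comNzRingType) n (A B : {poly R}) (u v : 'rV_n) :
  row_mx u v *m sylvester_mx n n A B =
  poly_rV (A * rVpoly u + B * rVpoly v).
Proof.
rewrite mul_row_col raddfD /=; congr (_ + _);
  rewrite mulmx_sum_row [rVpoly _]poly_def mulr_sumr raddf_sum;
  apply: eq_bigr => i _; rewrite rowK valK /= -scalerAr; symmetry; exact: linearZ.
Qed.

Lemma monic_size_mul (R : comNzRingType) (A P : {poly R}) :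
  A \is monic -> P != 0 -> (size A <= size (A * P)%R)%N.
Proof.
move=> mA P0; rewrite size_monicM //.
by rewrite -(prednK (n := size P)) ?size_poly_gt0 // addnS /= leq_addr.
Qed.

Lemma size_mul_le (R : nzSemiRingType) (P Q : {poly R}) m n :
  (size P <= m)%N -> (size Q <= n)%N -> (size (P * Q)%R <= (m + n).-1)%N.
Proof.
move=> sP sQ; rewrite (leq_trans (size_polyMleq _ _)) //.
by rewrite -!subn1 leq_sub2r // leq_add.
Qed.

Lemma size_add_le (R : nzSemiRingType) (P Q : {poly R}) m :
  (size P <= m)%N -> (size Q <= m)%N -> (size (P + Q)%R <= m)%N.
Proof. by move=> sP sQ; rewrite (leq_trans (size_polyD _ _)) // geq_max sP. Qed.

Lemma size_sub_le (R : nzRingType) (P Q : {poly R}) m :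
  (size P <= m)%N -> (size Q <= m)%N -> (size (P - Q)%R <= m)%N.
Proof. by move=> sP sQ; rewrite size_add_le ?size_polyN. Qed.

Lemma dvd_small_eq0 (R : comNzRingType) n (A W P : {poly R}) :
  A \is monic -> size A = n.+1 -> P = A * W -> (size P <= n)%N -> P = 0.
Proof.
move=> mA sA eP sP; have [W0|W0] := eqVneq W 0; first by rewrite eP W0 mulr0.
by have := monic_size_mul mA W0; rewrite -eP sA ltnNge sP.
Qed.

Lemma bezout_rel_unique (R : comNzRingType) n (A B U V U' V' : {poly R}) :
  A \is monic -> size A = n.+1 ->
  bezout_rel n A B U V -> bezout_rel n A B U' V' -> U = U' /\ V = V'.
Proof.
move=> mA sA [e _ sV] [e' _ sV'].
have eA : A * (U - U') = B * (V' - V).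
  have eq2 : A * U + B * V = A * U' + B * V' by rewrite e e'.
  by rewrite mulrBr mulrBr; apply/eqP; rewrite subr_eq addrAC eq_sym subr_eq eq2 addrC.
have dV : V - V' = A * (U * (V - V') - V * (U - U')).
  transitivity ((A * U + B * V) * (V - V')); first by rewrite e mul1r.
  by rewrite [RHS]mulrBr (mulrCA A V) eA; ring.
have V0 : V - V' = 0.
  exact: (dvd_small_eq0 mA sA dV (size_sub_le sV sV')).
have VV : V = V' by apply/eqP; rewrite -subr_eq0 V0.
split=> //; apply/eqP; rewrite -subr_eq0.
by rewrite -(mulrI_eq0 _ (monic_lreg mA)) eA VV subrr mulr0.
Qed.

Lemma ratfun_bezout (R : comUnitRingType) n (A B : {poly R}) :
  ratfun_pt n A B -> exists U V, bezout_rel n A B U V.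
Proof.
case: n => [|n] [mA sA sB uS].
  have -> : A = 1 by rewrite [A]size1_polyC ?sA //; move/eqP: mA; rewrite /lead_coef sA => ->.
  by exists 1, 0; split; rewrite ?mulr0 ?mulr1 ?addr0 ?size_poly1 ?size_poly0.
pose S := sylvester_mx n.+1 n.+1 A B.
pose w := poly_rV 1 *m invmx S : 'rV_(n.+1 + n.+1).
have wS : w *m S = poly_rV 1 by rewrite mulmxKV.
pose U := rVpoly (lsubmx w); pose V := rVpoly (rsubmx w).
have sU : (size U <= n.+1)%N by exact: size_poly.
have sV : (size V <= n.+1)%N by exact: size_poly.
have sBV : (size (B * V)%R <= n.+1 + n)%N.
  by rewrite (leq_trans (size_mul_le sB sV)) // addnS.
have e : A * U + B * V = 1.
  move: wS; rewrite -[w]hsubmxK mul_sylvester_mx => /(congr1 rVpoly).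
  rewrite !poly_rV_K // ?size_poly1 //.
  rewrite (leq_trans (size_polyD _ _)) // geq_max (leq_trans sBV) ?andbT ?addnS //.
  by rewrite (leq_trans (size_mul_le (eq_leq sA) sU)) // addSn /= addnS.
exists U, V; split => //=.
(* The Sylvester system bounds [U] only as it bounds [V]; one more degree is gained from A U = 1 - B
   V, [A] being monic. *)
have [->|U0] := eqVneq U 0; first by rewrite size_poly0.
have : (size (A * U)%R <= n.+1 + n)%N.
  rewrite [A * U](canRL (addrK _) e).
  by rewrite (leq_trans (size_polyD _ _)) // geq_max size_polyN sBV size_poly1.
by rewrite size_monicM // sA; move: (size U) => s; lia.
Qed.

Lemma row_surj_unit (R : comUnitRingType) n (S : 'M[R]_n) :
  (forall r : 'rV_n, exists w : 'rV_n, w *m S = r) -> \det S \is a GRing.unit.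
Proof.
move=> surj.
have [F FE] : exists F : 'I_n -> 'rV_n, forall i, F i *m S = delta_mx 0 i.
  exact: (@fin_all_exists _ (fun=> 'rV_n) (fun i w => w *m S = delta_mx 0 i)).
have : (\matrix_i F i) *m S = 1%:M.
  by apply/row_matrixP=> i; rewrite row_mul rowK FE row1.
by case/mulmx1_unit.
Qed.

(** Surjectivity of the Sylvester map suffices: P = A (U P) + B (V P), and dividing V P by the monic
    [A] brings both cofactors within the degree bounds. As [U] and [V] may have any degree, every
    later membership proof reduces to exhibiting some Bezout relation. *)
Lemma bezout_ratfun (R : comUnitRingType) n (A B U V : {poly R}) :
  A \is monic -> size A = n.+1 -> (size B <= n)%N -> A * U + B * V = 1 ->
  ratfun_pt n A B.
Proof.
move=> mA sA sB e; split=> //.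
pose S := sylvester_mx n n A B.
suff surj (P : {poly R}) : (size P <= n + n)%N ->
    exists w : 'rV_(n + n), w *m S = poly_rV P.
  apply: row_surj_unit => r.
  have [|w wE] := surj (rVpoly r); first exact: size_poly.
  by exists w; rewrite wE rVpolyK.
move=> sP.
pose Q := Pdiv.Ring.rdivp (V * P) A; pose W := Pdiv.Ring.rmodp (V * P) A.
have eW : V * P = Q * A + W by apply: Pdiv.RingMonic.rdivp_eq.
have sW : (size W <= n)%N by rewrite -ltnS -sA Pdiv.Ring.ltn_rmodp monic_neq0.
pose Z := U * P + B * Q.
have eP : P = A * Z + B * W.
  rewrite -[LHS]mul1r -e /Z (_ : W = V * P - Q * A); first by ring.
  by rewrite eW addrAC subrr add0r.
have sZ : (size Z <= n)%N.
  have [->|Z0] := eqVneq Z 0; first by rewrite size_poly0.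
  have: (size (A * Z)%R <= n + n)%N.
    rewrite [A * Z](canRL (addrK _) (esym eP)).
    rewrite (leq_trans (size_polyD _ _)) // geq_max sP size_polyN.
    rewrite (leq_trans (size_polyMleq _ _)) //.
    by rewrite (leq_trans (leq_pred _)) // leq_add.
  by rewrite size_monicM // sA addSn /= leq_add2l.
exists (row_mx (poly_rV Z) (poly_rV W)).
by rewrite mul_sylvester_mx !poly_rV_K // -eP.
Qed.

Lemma bez_UVP (R : comUnitRingType) n (A B U V : {poly R}) :
  A \is monic -> size A = n.+1 -> bezout_rel n A B U V ->
  bez_UV n A B = (U, V).
Proof.
move=> mA sA r; rewrite /bez_UV.
have /epsilon_spec := ex_intro (fun uv => bezout_rel n A B uv.1 uv.2) (U, V) r.
move=> /(_ (inhabits (0, 0))); case: (epsilon _ _) => U' V' /= r'.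
by have [-> ->] := bezout_rel_unique mA sA r r'.
Qed.

(** The Bezout coefficients of the sum are the second column of the product of the two matrices. [U]
    and [V] are arguments, with a weak bound on [U], so that relations written down by hand over
    k[T] fit. *)
Lemma ratfun_oplus (R : comUnitRingType) n1 n2 (A1 B1 U V A2 B2 : {poly R}) :
  A1 \is monic -> size A1 = n1.+1 -> (size B1 <= n1)%N ->
  A1 * U + B1 * V = 1 -> (size U <= n1.+1)%N -> (size V <= n1)%N ->
  ratfun_pt n2 A2 B2 ->
  ratfun_pt (n1 + n2) (A1 * A2 - V * B2) (B1 * A2 + U * B2).
Proof.
move=> mA1 sA1 sB1 e sU sV r2; have [mA2 sA2 sB2 _] := r2.
have [U2 [V2 [e2 _ _]]] := ratfun_bezout r2.
have sVB : (size (V * B2)%R <= n1 + n2)%N.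
  by rewrite (leq_trans (size_mul_le sV sB2)) ?leq_pred.
have sAA : size (A1 * A2) = (n1 + n2).+1.
  by rewrite size_monicM ?monic_neq0 // sA1 sA2 addnS.
apply: (@bezout_ratfun _ _ _ _ (U * U2 - B1 * V2) (A1 * V2 + V * U2)).
- rewrite monicE lead_coefDl ?size_polyN ?sAA ?ltnS //.
  by rewrite -monicE monicMl.
- by rewrite size_polyDl ?sAA // size_polyN ltnS.
- rewrite size_add_le //.
    by rewrite (leq_trans (size_mul_le sB1 (eq_leq sA2))) ?addnS.
  by rewrite (leq_trans (size_mul_le sU sB2)) ?addSn.
- transitivity ((A1 * U + B1 * V) * (A2 * U2 + B2 * V2)); first by ring.
  by rewrite e e2 mulr1.
Qed.

(* [X / u] (+)^N [A / B] *)
Definition stepF (R : comUnitRingType) (u : R) (f : {poly R} * {poly R}) :=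
  ('X * f.1 - u^-1 *: f.2, u *: f.1).

Definition sumF (R : comUnitRingType) (us : seq R) : {poly R} * {poly R} :=
  foldr (@stepF R) (1, 0) us.

Lemma ratfun_lin (R : comUnitRingType) n (a u : R) (A B : {poly R}) :
  u \is a GRing.unit -> ratfun_pt n A B ->
  ratfun_pt n.+1 (('X + a%:P) * A - u^-1 *: B) (u *: A).
Proof.
move=> uu r.
have := @ratfun_oplus _ 1 n ('X + a%:P) u%:P 0 u^-1%:P A B.
rewrite mul0r addr0 !mul_polyC; apply=> //.
- exact: monicXaddC.
- exact: size_XaddC.
- exact: size_polyC_leq1.
- by rewrite mulr0 add0r -mul_polyC -polyCM mulrV.
- by rewrite size_poly0.
- exact: size_polyC_leq1.
Qed.

Lemma ratfun_stepF (R : comUnitRingType) n (u : R) (f : {poly R} * {poly R}) :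
  u \is a GRing.unit -> ratfun_pt n f.1 f.2 ->
  ratfun_pt n.+1 (stepF u f).1 (stepF u f).2.
Proof. by move=> uu /(ratfun_lin 0 uu); rewrite addr0. Qed.

Lemma ratfun_1_0 (R : comUnitRingType) : ratfun_pt 0 (1 : {poly R}) 0.
Proof.
apply: (@bezout_ratfun _ _ _ _ 1 0); rewrite ?monic1 ?size_poly1 ?size_poly0 //.
by rewrite mulr1 mul0r addr0.
Qed.

Lemma ratfun_sumF (k : fieldType) (us : seq k) :
  all (fun u => u != 0) us -> ratfun_pt (size us) (sumF us).1 (sumF us).2.
Proof.
elim: us => [_|u us IH] /=; first exact: ratfun_1_0.
by case/andP=> u0 /IH; apply: ratfun_stepF; rewrite unitfE.
Qed.

Lemma bezout_stepF (R : comUnitRingType) n (u : R) (A B U V : {poly R}) :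
  u \is a GRing.unit -> bezout_rel n A B U V ->
  bezout_rel n.+1 (stepF u (A, B)).1 (stepF u (A, B)).2
    (- (u *: V)) ('X * V + u^-1 *: U).
Proof.
move=> uu [e sU sV]; split => /=.
- have uV : (u^-1)%:P * u%:P = 1 :> {poly R} by rewrite -polyCM mulVr.
  by rewrite -[RHS]e -!mul_polyC -[RHS]mul1r -uV; ring.
- rewrite size_polyN (leq_trans (size_scale_leq _ _)) //.
- rewrite size_add_le //.
    have := size_mul_le (eq_leq (size_polyX R)) sV; rewrite -commr_polyX.
    by rewrite addSn.
  rewrite (leq_trans (size_scale_leq _ _)) // (leq_trans sU) //.
  by case: (n) => // m; apply: leqW.
Qed.

(** * The Bezout form *)

(* [bez_quot] over a domain rather than a field, in order to reach k[T]. *)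
Definition bezq (R : idomainType) (A B : {poly R}) : {poly {poly R}} :=
  (A^:P * B%:P - A%:P * B^:P) %/ ('X - 'Y).

Lemma bezqE (R : idomainType) (A B : {poly R}) :
  bezq A B * ('X - 'Y) = A^:P * B%:P - A%:P * B^:P.
Proof.
have hX (P : {poly R}) : P^:P.['X] = P by exact: comp_polyXr.
have /factor_theorem [q Eq] : root (A^:P * B%:P - A%:P * B^:P) 'X.
  by rewrite rootE !hornerE !hX subrr.
by rewrite /bezq Eq Pdiv.IdomainMonic.mulpK // monicXsubC.
Qed.

Lemma bezq_unique (R : idomainType) (A B : {poly R}) Q :
  Q * ('X - 'Y) = A^:P * B%:P - A%:P * B^:P -> Q = bezq A B.
Proof. by rewrite -bezqE => /mulIf; apply; rewrite polyXsubC_eq0. Qed.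

Lemma bezq_swap (R : idomainType) (A B : {poly R}) :
  swapXY (bezq A B) = bezq A B.
Proof.
apply: bezq_unique; rewrite (_ : 'X - 'Y = - swapXY ('X - 'Y)); last first.
  by rewrite [swapXY _]raddfB /= swapXY_X swapXY_Y opprB.
rewrite mulrN -rmorphM bezqE rmorphB !rmorphM /=.
by rewrite !swapXY_polyC !swapXY_map_polyC opprB; congr (_ - _).
Qed.

Lemma size_bezq (R : idomainType) n (A B : {poly R}) :
  (size A <= n.+1)%N -> (size B <= n.+1)%N -> (size (bezq A B) <= n)%N.
Proof.
move=> sA sB; have [->|q0] := eqVneq (bezq A B) 0; first by rewrite size_poly0.
have: (size (bezq A B * ('X - 'Y))%R <= n.+1)%N.
  have sC (P Q : {poly R}) : (size P <= n.+1)%N -> (size (P^:P * Q%:P)%R <= n.+1)%N.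
    move=> sP; have sP' : (size P^:P <= n.+1)%N by rewrite size_map_polyC.
    by rewrite (leq_trans (size_mul_le sP' (size_polyC_leq1 Q))) ?addn1.
  by rewrite bezqE size_sub_le ?sC // mulrC sC.
by rewrite size_Mmonic ?monicXsubC // size_XsubC addn2.
Qed.

Lemma bezq_map (R S : idomainType) (f : {rmorphism R -> S}) (A B : {poly R}) :
  map_poly (map_poly f) (bezq A B) = bezq (map_poly f A) (map_poly f B).
Proof.
have mC (P : {poly R}) : map_poly (map_poly f) P^:P = (map_poly f P)^:P.
  by rewrite -!map_poly_comp; apply: eq_map_poly => x /=; rewrite map_polyC.
apply: bezq_unique.
transitivity (map_poly (map_poly f) (bezq A B * ('X - 'Y))).
  by rewrite rmorphM rmorphB /= map_polyX map_polyC /= map_polyX.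
by rewrite bezqE rmorphB !rmorphM /= !mC !map_polyC.
Qed.

Definition bezmx (R : idomainType) n (A B : {poly R}) : 'M[R]_n :=
  \matrix_(i < n, j < n) (bezq A B)`_i`_j.

Lemma Bez_mxE (k : fieldType) n (A B : {poly k}) : Bez_mx n A B = bezmx n A B.
Proof. by []. Qed.

Lemma bezmx_map (R S : idomainType) (f : {rmorphism R -> S}) n (A B : {poly R}) :
  map_mx f (bezmx n A B) = bezmx n (map_poly f A) (map_poly f B).
Proof. by apply/matrixP=> i j; rewrite !mxE -bezq_map !coef_map. Qed.

Lemma bezmx_sym (R : idomainType) n (A B : {poly R}) : (bezmx n A B)^T = bezmx n A B.
Proof. by apply/matrixP=> i j; rewrite !mxE -[in LHS]bezq_swap coef_swapXY. Qed.

Lemma bezq_coef_out (R : idomainType) n (A B : {poly R}) i j :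
  (size A <= n.+1)%N -> (size B <= n.+1)%N -> (n <= i)%N || (n <= j)%N ->
  (bezq A B)`_i`_j = 0.
Proof.
move=> sA sB; have h a b : (n <= a)%N -> (bezq A B)`_a`_b = 0.
  by move=> na; rewrite (nth_default _ (leq_trans (size_bezq sA sB) na)) coef0.
by case/orP=> [/h->//|/h e]; rewrite -bezq_swap coef_swapXY e.
Qed.

(* [h] is (A(X) - A(Y)) / (X - Y); its coefficients are the Horner polynomials
   of [A], which form a unitriangular basis. *)
Lemma bezq1_coef (R : idomainType) n (A : {poly R}) m :
  A \is monic -> size A = n.+1 -> (m < n)%N ->
  let h := (bezq A 1)`_(n.-1 - m) in h \is monic /\ size h = m.+1.
Proof.
move=> mA sA; have s1 : (size (1 : {poly R})%R <= n.+1)%N by rewrite size_poly1.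
have rec i : (bezq A 1)`_i = (bezq A 1)`_i.+1 * 'X + (A`_i.+1)%:P.
  have /(congr1 (coefp i.+1)) := bezqE A 1; rewrite polyC1 rmorph1 !mulr1 /=.
  rewrite mulrBr !coefB coefMX coefMC coef_map coefC /= subr0.
  by move/(canRL (subrK _)); rewrite addrC.
elim: m => [|m IH] lmn /=.
  rewrite subn0 rec prednK // (_ : (bezq A 1)`_n = 0); last first.
    by rewrite nth_default // size_bezq ?sA.
  have -> : A`_n = 1 by rewrite -(eqP mA) /lead_coef sA.
  by rewrite mul0r add0r monic1 size_poly1.
have [|mh sh] := IH; first exact: ltnW.
rewrite rec (_ : (n.-1 - m.+1).+1 = n.-1 - m)%N; last by lia.
have sX : size ((bezq A 1)`_(n.-1 - m) * 'X) = m.+2.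
  by rewrite size_mulX ?monic_neq0 // sh.
split; last by rewrite size_polyDl // sX (leq_ltn_trans (size_polyC_leq1 _)).
rewrite monicE lead_coefDl ?lead_coefMX ?(eqP mh) //.
by rewrite sX (leq_ltn_trans (size_polyC_leq1 _)).
Qed.

Lemma bezq1_span (R : idomainType) n (A P : {poly R}) :
  A \is monic -> size A = n.+1 -> (size P <= n)%N ->
  exists v : 'I_n -> R, P = \sum_i v i *: (bezq A 1)`_i.
Proof.
move=> mA sA.
suff span m : (m <= n)%N -> forall Q : {poly R}, (size Q <= m)%N ->
    exists v : 'I_n -> R, Q = \sum_i v i *: (bezq A 1)`_i by exact: span.
elim: m => [|m IH] lmn Q sQ.
  exists (fun=> 0); rewrite big1 => [|i _]; last exact: scale0r.
  by apply/eqP; rewrite -size_poly_leq0.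
have [mh sh] := bezq1_coef mA sA lmn.
set h := (bezq A 1)`_(n.-1 - m) in mh sh.
have [|v Ev] := IH (ltnW lmn) (Q - Q`_m *: h).
  apply/leq_sizeP=> j; rewrite leq_eqVlt => /orP[/eqP<-|lmj].
      by rewrite coefB coefZ (_ : h`_m = 1) ?mulr1 ?subrr // -(eqP mh) /lead_coef sh.
  rewrite coefB coefZ (nth_default _ (leq_trans sQ lmj)).
  by rewrite [h`_j]nth_default ?sh // mulr0 subr0.
have lt : (n.-1 - m < n)%N by lia.
exists (fun i => v i + (i == Ordinal lt)%:R * Q`_m).
under eq_bigr do rewrite scalerDl.
rewrite big_split /= -Ev (bigD1 (Ordinal lt)) //= eqxx mul1r big1 ?addr0 ?subrK //.
by move=> i /negPf->; rewrite mul0r scale0r.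
Qed.

(** Modulo [A], the rows of the Bezout matrix are [B] times the Horner polynomials of [A]. The
    matrix thus represents multiplication by [B] modulo [A], with inverse multiplication by [V]: a
    polynomial Q is reached from the Horner coordinates of V Q modulo [A]. *)
Lemma bezmx_unit (R : idomainType) n (A B : {poly R}) :
  ratfun_pt n A B -> \det (bezmx n A B) \is a GRing.unit.
Proof.
move=> r; have [mA sA sB _] := r; have [U [V [e _ _]]] := ratfun_bezout r.
have sA' : (size A <= n.+1)%N by rewrite sA.
have sB' : (size B <= n.+1)%N by exact: leqW.
have splitq : bezq A B = B%:P * bezq A 1 - A%:P * bezq B 1.
  apply/esym/bezq_unique; rewrite mulrBl -!mulrA !bezqE rmorph1 !mulr1.
  by ring.
apply: row_surj_unit => w; pose Q := rVpoly w.
have sQ : (size Q <= n)%N by exact: size_poly.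
have [D [W [eW sW]]] : exists D W, V * Q = D * A + W /\ (size W <= n)%N.
  exists (Pdiv.Ring.rdivp (V * Q) A), (Pdiv.Ring.rmodp (V * Q) A).
  split; first exact: Pdiv.RingMonic.rdivp_eq.
  by rewrite -ltnS -sA Pdiv.Ring.ltn_rmodp monic_neq0.
have [v Ev] := bezq1_span mA sA sW.
exists (\row_i v i).
have rowE (i : 'I_n) : rVpoly (row i (bezmx n A B)) = (bezq A B)`_i.
  apply/polyP=> j; rewrite coef_rVpoly; case: insubP => [j' _ <-|].
    by rewrite !mxE.
  by rewrite -leqNgt => nj; rewrite (bezq_coef_out sA' sB') // nj orbT.
rewrite mulmx_sum_row -[RHS]rVpolyK -/Q.
apply: (can_inj (@rVpolyK _ _)); rewrite poly_rV_K //.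
apply/eqP; rewrite -subr_eq0; apply/eqP.
pose G := \sum_i v i *: (bezq B 1)`_i.
apply: (@dvd_small_eq0 _ n A (- G - U * Q - B * D)) => //; last first.
  by rewrite size_sub_le ?size_poly.
transitivity (B * W - A * G - Q); last first.
  have {}eW : W = V * Q - D * A by rewrite eW addrAC subrr add0r.
  by rewrite -[X in _ - _ - X]mul1r -e eW; ring.
congr (_ - _); rewrite Ev /G !mulr_sumr -sumrB linear_sum /=.
apply: eq_bigr => i _; rewrite linearZ /= rowE mxE splitq coefB !coefCM.
by rewrite scalerBr !scalerAr.
Qed.

Lemma bezmx_symnd (R : idomainType) n (A B : {poly R}) :
  ratfun_pt n A B -> symnd_pt (bezmx n A B).
Proof. by move=> r; split; [exact: bezmx_sym | exact: bezmx_unit]. Qed.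

Lemma bezq_stepF (R : idomainType) (u : R) (A B : {poly R}) :
  u \is a GRing.unit ->
  bezq (stepF u (A, B)).1 (stepF u (A, B)).2 =
  (u *: A)^:P * A%:P + bezq A B.
Proof.
move=> uu; apply/esym/bezq_unique; rewrite mulrDl bezqE /= -!mul_polyC.
have uV : (u^-1)%:P * u%:P = 1 :> {poly R} by rewrite -polyCM mulVr.
have uVP : (u^-1)%:P%:P * u%:P%:P = 1 :> {poly {poly R}} by rewrite -polyCM uV.
rewrite !(rmorphM, rmorphB) /= !map_polyC !map_polyX /=.
rewrite -[X in _ + (X - _)]mul1r -[X in _ + (_ - X)]mul1r -uVP; ring.
Qed.

(** * Congruence of symmetric matrices *)

Definition mat2 (R : nzRingType) (a b c d : R) : 'M[R]_2 :=
  \matrix_(i, j) if i == 0 then if j == 0 then a else b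
                 else if j == 0 then c else d.

Lemma mat2P (R : nzRingType) (M : 'M[R]_2) :
  M = mat2 (M 0 0) (M 0 1) (M 1 0) (M 1 1).
Proof.
by apply/matrixP=> i j; rewrite mxE; case: i => [[|[|[]]] ?] //; case: j => [[|[|[]]] ?] //;
   congr (M _ _); apply: val_inj.
Qed.

Lemma mul_mat2 (R : nzRingType) (a b c d a' b' c' d' : R) :
  mat2 a b c d *m mat2 a' b' c' d' =
  mat2 (a * a' + b * c') (a * b' + b * d') (c * a' + d * c') (c * b' + d * d').
Proof.
apply/matrixP=> i j; rewrite !mxE !big_ord_recl big_ord0 addr0 !mxE /=.
by case: i => [[|[|[]]] ?] //; case: j => [[|[|[]]] ?].
Qed.

Lemma tr_mat2 (R : nzRingType) (a b c d : R) : (mat2 a b c d)^T = mat2 a c b d.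
Proof.
by apply/matrixP=> i j; rewrite !mxE;
   case: i => [[|[|[]]] ?] //; case: j => [[|[|[]]] ?].
Qed.

Lemma det_mat2 (R : comNzRingType) (a b c d : R) :
  \det (mat2 a b c d) = a * d - b * c.
Proof.
rewrite (expand_det_row _ ord0) !big_ord_recl big_ord0 /cofactor !det_mx11 !mxE /=.
by rewrite expr0 expr1 addr0 mul1r mulN1r mulrN.
Qed.

Lemma map_mat2 (R S : nzRingType) (f : R -> S) (a b c d : R) :
  map_mx f (mat2 a b c d) = mat2 (f a) (f b) (f c) (f d).
Proof.
by apply/matrixP=> i j; rewrite !mxE;
   case: i => [[|[|[]]] ?] //; case: j => [[|[|[]]] ?].
Qed.

Definition cg (R : comNzRingType) n (g M : 'M[R]_n) : 'M[R]_n := g^T *m M *m g.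

Lemma cg_mul (R : comNzRingType) n (g h M : 'M[R]_n) : cg (g *m h) M = cg h (cg g M).
Proof. by rewrite /cg trmx_mul !mulmxA. Qed.

Lemma cg1 (R : comNzRingType) n (M : 'M[R]_n) : cg 1%:M M = M.
Proof. by rewrite /cg trmx1 mul1mx mulmx1. Qed.

Lemma cg_sym (R : comNzRingType) n (g M : 'M[R]_n) : M^T = M -> (cg g M)^T = cg g M.
Proof. by move=> sM; rewrite /cg !trmx_mul sM trmxK mulmxA. Qed.

Lemma det_cg (R : comNzRingType) n (g M : 'M[R]_n) :
  \det (cg g M) = \det g ^+ 2 * \det M.
Proof. by rewrite /cg !det_mulmx det_tr mulrAC. Qed.

Lemma det_cg1 (R : comNzRingType) n (g M : 'M[R]_n) :
  \det g = 1 -> \det (cg g M) = \det M.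
Proof. by move=> dg; rewrite det_cg dg expr1n mul1r. Qed.

Lemma det1_unit (R : comUnitRingType) n (g : 'M[R]_n) : \det g = 1 -> g \in unitmx.
Proof. by rewrite unitmxE => ->; exact: unitr1. Qed.

Lemma det1_inv (R : comUnitRingType) n (g : 'M[R]_n) : \det g = 1 -> \det (invmx g) = 1.
Proof. by rewrite det_inv => ->; rewrite invr1. Qed.

Lemma map_cg (R S : comNzRingType) (f : {rmorphism R -> S}) n (g M : 'M[R]_n) :
  map_mx f (cg g M) = cg (map_mx f g) (map_mx f M).
Proof. by rewrite /cg !map_mxM map_trmx. Qed.

Lemma cg_block_diag (R : comNzRingType) m n (g : 'M[R]_m) (h : 'M[R]_n) a b c d :
  cg (block_mx g 0 0 h) (block_mx a b c d) =
  block_mx (cg g a) (g^T *m b *m h) (h^T *m c *m g) (cg h d).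
Proof.
rewrite /cg tr_block_mx !trmx0 !mulmx_block.
by rewrite !(mul0mx, mulmx0, addr0, add0r).
Qed.

Lemma det_block_diag (R : comNzRingType) m n (g : 'M[R]_m) (h : 'M[R]_n) :
  \det (block_mx g 0 0 h) = \det g * \det h.
Proof. exact: det_lblock. Qed.

Lemma cg_clear (R : comUnitRingType) m n (P : 'M[R]_m) (r : 'M[R]_(m, n)) N :
  P^T = P -> P \in unitmx ->
  cg (block_mx 1%:M (- (invmx P *m r)) 0 1%:M) (block_mx P r r^T N) =
  block_mx P 0 0 (N - r^T *m invmx P *m r).
Proof.
move=> sP uP; have sPi : (invmx P)^T = invmx P by rewrite trmx_inv sP.
rewrite /cg tr_block_mx !trmx0 !trmx1 !mulmx_block.
rewrite !(mul0mx, mulmx0, mul1mx, mulmx1, addr0).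
have e1 : P *m - (invmx P *m r) + r = 0.
  by rewrite mulmxN mulmxA mulmxV // mul1mx addNr.
have e2 : (- (invmx P *m r))^T *m P + r^T = 0.
  by rewrite -[P in _ *m P]sP -trmx_mul -raddfD /= e1 trmx0.
by rewrite e1 e2 mul0mx add0r raddfN /= trmx_mul sPi mulNmx addrC.
Qed.

(** The cofactors [a'], [b'] are required to be comaximal, so that a matrix of determinant 1
    carrying (a, b) to (d, 0) exists even when a = b = 0. *)
Definition bezout_ring (R : comNzRingType) := forall a b : R,
  exists a' b' u v d, [/\ a = a' * d, b = b' * d & a' * u + b' * v = 1].

Lemma field_bezout_ring (k : fieldType) : bezout_ring k.
Proof.
move=> a b; have [->|a0] := eqVneq a 0.
  by exists 0, 1, 0, 1, b; rewrite !mul0r !mul1r add0r.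
by exists 1, (b / a), 1, 0, a; rewrite !mul1r mulr0 addr0 divfK.
Qed.

Lemma poly_bezout_ring (k : fieldType) : bezout_ring {poly k}.
Proof.
move=> a b; pose d := gcdp a b.
have [d0|d0] := eqVneq d 0.
  move: (d0) => /eqP; rewrite gcdp_eq0 => /andP[/eqP-> /eqP->].
  by exists 1, 0, 1, 0, 0; rewrite !mulr0 !mulr1 addr0.
have [[u v] /= ] := Bezoutp a b; rewrite -/d => /eqpP [[c1 c2] /= /andP[c10 c20] e].
have /dvdpP [a' Ea] := dvdp_gcdl a b; have /dvdpP [b' Eb] := dvdp_gcdr a b.
exists a', b', ((c1 / c2) *: u), ((c1 / c2) *: v), d; split => //.
apply: (mulIf d0); apply: (@scalerI _ _ c2 c20).
rewrite -/d in Ea Eb.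
have {}e : c1 *: (u * (a' * d) + v * (b' * d)) = c2 *: d by rewrite -Ea -Eb.
rewrite mul1r -e -!mul_polyC.
have ec : c2%:P * (c1 / c2)%:P = c1%:P by rewrite -polyCM mulrC divfK.
by rewrite -ec; ring.
Qed.

Lemma row_reduce (R : comNzRingType) m (x : 'rV[R]_m.+1) : bezout_ring R ->
  exists g d, \det g = 1 /\ x *m g = d *: delta_mx 0 0.
Proof.
move=> hR; elim: m x => [|m IH] x.
  exists 1%:M, (x 0 0); rewrite det1 mulmx1; split=> //.
  by apply/rowP=> i; rewrite !mxE !ord1 eqxx mulr1.
have [g' [d' [dg' E']]] := IH (rsubmx (x : 'rV_(1 + m.+1))).
pose h := block_mx 1%:M 0 0 g' : 'M_(1 + m.+1).
have zE : (x : 'rV_(1 + m.+1)) *m h = row_mx (lsubmx (x : 'rV_(1 + m.+1))) (d' *: delta_mx 0 0).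
  rewrite -{1}(hsubmxK (x : 'rV_(1 + m.+1))) mul_row_block !mulmx0 mulmx1.
  by rewrite addr0 add0r E'.
move: (lsubmx _) zE => x0 zE.
have [a' [b' [u [v [d [Ea Eb Euv]]]]]] := hR (x0 0 0) d'.
(* Its determinant is a' u + b' v = 1, and it sends (a' d, b' d) to (d, 0). *)
pose f := block_mx (mat2 u (- b') v a') 0 0 1%:M : 'M_(2 + m).
exists (h *m f), d; split.
  have dh : \det h = 1 by rewrite /h det_block_diag dg' det1 mulr1.
  have df : \det f = 1.
    by rewrite /f det_block_diag det1 mulr1 det_mat2 -Euv; ring.
  by rewrite det_mulmx dh df mulr1.
rewrite mulmxA zE.
have -> : row_mx x0 (d' *: delta_mx 0 0) =
    row_mx (\row_(i < 2) if i == 0 then x0 0 0 else d') 0 :> 'rV_(2 + m).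
  apply/rowP=> j; rewrite !mxE.
  case: splitP => i /= Ej; case: splitP => i' /= Ej'; rewrite !mxE ?ord1.
  - by rewrite (_ : i' = 0) //; apply: val_inj; rewrite /= -Ej' Ej ord1.
  - by move: (ltn_ord i); rewrite ltnS leqn0 -Ej Ej'.
  - have -> : i = 0 by apply: val_inj => /=; move: (ltn_ord i'); rewrite -Ej' Ej; case: (val i).
    have -> : (i' == 0) = false by apply/negP=> /eqP i0; move: Ej'; rewrite Ej i0.
    by rewrite !eqxx mulr1.
  - case: (eqVneq i 0) => [i0|]; last by rewrite mulr0.
    by move: Ej'; rewrite Ej i0.
set y := \row_i _.
have -> : (row_mx y 0 : 'rV_(2 + m)) *m f = row_mx (y *m mat2 u (- b') v a') 0.
  by rewrite mul_row_block !mulmx0 !mul0mx !addr0.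
apply/rowP=> j; rewrite !mxE.
case: splitP => i /= Ej; last first.
  by rewrite !mxE (_ : (j == 0) = false) ?mulr0 //; apply/negP=> /eqP j0; move: Ej; rewrite j0.
rewrite !mxE !big_ord_recl big_ord0 !mxE /= addr0 Ea Eb.
case: i Ej => [[|[|[]]] ?] //= Ej.
  have -> : j = 0 by apply: val_inj.
  by rewrite eqxx mulr1 -[RHS]mul1r -Euv; ring.
rewrite (_ : (j == 0) = false) ?mulr0; first by ring.
by apply/negP=> /eqP j0; move: Ej; rewrite j0.
Qed.

(** * Splitting a first vector; connectedness of SL_n *)

Lemma ublock_e1 (R : comNzRingType) m n (B : 'M[R]_(m.+1, n)) (D : 'M[R]_n) :
  block_mx 1%:M B 0 D *m (delta_mx 0 0 : 'cV_(m.+1 + n)) = delta_mx 0 0.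
Proof.
have -> : (delta_mx 0 0 : 'cV[R]_(m.+1 + n)) = col_mx (delta_mx 0 0) 0.
  apply/colP=> i; rewrite !mxE; case: splitP => j Ej; rewrite !mxE.
    by congr ((_ && _)%:R); apply/eqP/eqP=> [i0|j0]; apply: val_inj; rewrite /= -?Ej ?i0 // Ej j0.
  by case: eqP => // i0; move: Ej; rewrite i0.
by rewrite mul_block_col mul0mx mul1mx !mulmx0 !addr0.
Qed.

Lemma ulsubmx2 (R : nzRingType) n (M : 'M[R]_(2 + n)) :
  ulsubmx M = mat2 (M 0 0) (M 0 1) (M 1 0) (M 1 1).
Proof. by rewrite [LHS]mat2P !mxE; congr mat2; congr (M _ _); apply: val_inj. Qed.

Lemma corner (R : nzRingType) m n (M : 'M[R]_(m.+1 + n)) : M 0 0 = ulsubmx M 0 0.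
Proof.
rewrite [RHS]mxE [RHS]mxE (_ : lshift n (0 : 'I_m.+1) = 0 :> 'I_(m.+1 + n)) //.
exact: val_inj.
Qed.

(** Row reduction makes the first row (0, d, 0, ..., 0); expanding the determinant along it shows
    that d is a unit, so the first two vectors span a unimodular plane and its complement splits
    off. Fixing the first vector is what lets a splitting start from a prescribed vector. *)
Lemma cg_isotropic (R : comUnitRingType) n (H : 'M[R]_n.+2) :
  bezout_ring R -> H^T = H -> \det H \is a GRing.unit -> H 0 0 = 0 ->
  exists g c p N, [/\ \det g = 1, g *m delta_mx 0 0 = delta_mx 0 0 :> 'cV_n.+2,
    c \is a GRing.unit
    & cg g H = block_mx (mat2 0 c c p) 0 0 N :> 'M_(2 + n)].
Proof.
move=> hR sH uH H00.
have [g' [d [dg' Er]]] := row_reduce (ursubmx (H : 'M_(1 + n.+1))) hR.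
pose h := block_mx 1%:M 0 0 g' : 'M_(1 + n.+1).
have dh : \det h = 1 by rewrite /h det_block_diag det1 dg' mulr1.
have he : h *m delta_mx 0 0 = delta_mx 0 0 :> 'cV_n.+2.
    exact: (@ublock_e1 _ 0 n.+1).
pose H1 := cg h H : 'M_(2 + n).
have sH1 : H1^T = H1 by exact: cg_sym.
have row0 (j : 'I_n.+2) : H1 0 j = d * (j == 1)%:R.
  have EH : H1 = block_mx (ulsubmx (H : 'M_(1 + n.+1))) (d *: delta_mx 0 0)
      (g'^T *m dlsubmx (H : 'M_(1 + n.+1))) (cg g' (drsubmx (H : 'M_(1 + n.+1))))
      :> 'M_(1 + n.+1).
    rewrite /H1 -{1}(submxK (H : 'M_(1 + n.+1))) /h cg_block_diag.
    by rewrite trmx1 mul1mx mulmx1 Er /cg trmx1 mul1mx mulmx1.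
  case: (unliftP 0 j) => [i|] ->.
    have := congr1 (fun X : 'M_(1 + n.+1) => ursubmx X 0 i) EH.
    rewrite block_mxKur !mxE /= (_ : lshift _ 0 = 0); last exact: val_inj.
    by rewrite (_ : rshift 1 i = lift 0 i) //; apply: val_inj.
  have := congr1 (fun X : 'M_(1 + n.+1) => ulsubmx X 0 0) EH.
  rewrite block_mxKul !mxE (_ : lshift _ 0 = 0); last exact: val_inj.
  by rewrite H00 mulr0.
have ud : d \is a GRing.unit.
  have : \det H1 \is a GRing.unit by rewrite det_cg1.
  rewrite (expand_det_row _ (0 : 'I_n.+2)) (bigD1 (1 : 'I_n.+2)) //= big1.
    by rewrite row0 eqxx mulr1 addr0 unitrM => /andP[].
  by move=> j /negPf j1; rewrite row0 j1 mulr0 mul0r.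
pose P := ulsubmx H1; pose r := ursubmx H1.
have EP : P = mat2 0 d d (H1 1 1).
  have E10 : H1 1 0 = d by rewrite -sH1 mxE row0 mulr1.
  by rewrite /P ulsubmx2 !row0 E10 mulr0 mulr1.
have sP : P^T = P by rewrite EP tr_mat2.
have uP : P \in unitmx.
  by rewrite unitmxE EP det_mat2 mul0r sub0r unitrN unitrM ud.
have EH1 : H1 = block_mx P r r^T (drsubmx H1).
  by rewrite -[LHS]submxK /r trmx_ursub sH1.
pose f := block_mx 1%:M (- (invmx P *m r)) 0 1%:M : 'M_(2 + n).
exists (h *m f), d, (H1 1 1), (drsubmx H1 - r^T *m invmx P *m r); split => //.
- have df : \det f = 1 by rewrite /f det_ublock !det1 mulr1.
  by rewrite det_mulmx dh df mulr1.
- rewrite -mulmxA; have -> : f *m (delta_mx 0 0 : 'cV_(2 + n)) = delta_mx 0 0.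
    exact: ublock_e1.
  exact: he.
- have Ef := cg_clear r (drsubmx H1) sP uP.
  by rewrite -EP -Ef -EH1 cg_mul.
Qed.

Lemma cg_unit_corner (R : comUnitRingType) n (M : 'M[R]_n.+1) :
  M^T = M -> M 0 0 \is a GRing.unit ->
  exists g N, [/\ \det g = 1, g *m delta_mx 0 0 = delta_mx 0 0 :> 'cV_n.+1
    & cg g M = block_mx (M 0 0)%:M 0 0 N :> 'M_(1 + n)].
Proof.
move=> sM M0.
pose P := ulsubmx (M : 'M_(1 + n)); pose r := ursubmx (M : 'M_(1 + n)).
have EP : P = (M 0 0)%:M.
  rewrite [P]mx11_scalar /P !mxE; congr (_%:M); congr (M _ _); exact: val_inj.
have EM : M = block_mx P r r^T (drsubmx (M : 'M_(1 + n))).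
  by rewrite -[LHS](submxK (M : 'M_(1 + n))) /r trmx_ursub sM.
have uP : P \in unitmx by rewrite unitmxE EP det_scalar1.
have sP : P^T = P by rewrite EP tr_scalar_mx.
pose g := block_mx 1%:M (- (invmx P *m r)) 0 1%:M : 'M_(1 + n).
have dg : \det g = 1 by rewrite /g det_ublock !det1 mulr1.
have Eg := cg_clear r (drsubmx (M : 'M_(1 + n))) sP uP.
exists g, (drsubmx (M : 'M_(1 + n)) - r^T *m invmx P *m r); split=> //.
  exact: (@ublock_e1 _ 0 n).
by rewrite -EP -Eg -EM.
Qed.

Definition split_form (k : fieldType) n (M : 'M[k]_n.+1) : Prop :=
  (exists u N, u != 0 /\ M = block_mx u%:M 0 0 N :> 'M_(1 + n)) \/
  (match n return 'M[k]_n.+1 -> Prop with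
   | 0 => fun=> False
   | n'.+1 => fun M => exists c p N,
       c != 0 /\ M = block_mx (mat2 0 c c p) 0 0 N :> 'M_(2 + n')
   end M).

Lemma split_first (k : fieldType) n (M : 'M[k]_n.+1) : symnd_pt M ->
  exists g, [/\ \det g = 1, g *m delta_mx 0 0 = delta_mx 0 0 :> 'cV_n.+1
    & split_form (cg g M)].
Proof.
case=> sM uM; have [M0|M0] := eqVneq (M 0 0) 0; last first.
  have [|g [N [dg ge E]]] := cg_unit_corner sM; first by rewrite unitfE.
  by exists g; split=> //; left; exists (M 0 0), N.
case: n M sM uM M0 => [|n] M sM uM M0.
  by move: uM; rewrite det_mx11 M0 unitr0.
have [g [c [p [N [dg ge uc E]]]]] := cg_isotropic (@field_bezout_ring k) sM uM M0.
by exists g; split=> //; right; exists c, p, N; rewrite -unitfE.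
Qed.

Lemma symnd_cg (R : comUnitRingType) n (g M : 'M[R]_n) :
  \det g = 1 -> symnd_pt M -> symnd_pt (cg g M).
Proof. by move=> dg [sM uM]; split; [exact: cg_sym | rewrite det_cg1]. Qed.

(** A basis of volume 1 is taken with [x] on its first axis, and the splitting leaves that axis
    alone. A zero [x] is covered by a = 0. *)
Lemma split_adapted (k : fieldType) n (M : 'M[k]_n.+1) (x : 'cV_n.+1) :
  symnd_pt M -> exists t a, [/\ \det t = 1, x = a *: (t *m delta_mx 0 0)
    & split_form (cg t M)].
Proof.
move=> sM; have [g [a [dg Eg]]] := row_reduce x^T (@field_bezout_ring k).
have dt : \det (invmx g^T) = 1 by rewrite det1_inv // det_tr.
have [h [dh he sh]] := split_first (symnd_cg dt sM).
exists (invmx g^T *m h), a; split.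
- by rewrite det_mulmx dt dh mulr1.
- have ug : g^T \in unitmx by rewrite unitmx_tr det1_unit.
  have Ex : g^T *m x = a *: delta_mx 0 0.
    by rewrite -[x]trmxK -trmx_mul Eg linearZ /= trmx_delta.
  by rewrite -mulmxA he scalemxAr -Ex mulKmx.
- by rewrite cg_mul.
Qed.

(** * Connectedness of SL_n through naive homotopies *)

Definition path_to1 (k : fieldType) n (g : 'M[k]_n) : Prop :=
  exists G : 'M[{poly k}]_n,
    [/\ \det G = 1, map_mx (evT 0) G = 1%:M & map_mx (evT 1) G = g].

Lemma evTE (k : fieldType) (t : k) : evT t = horner_eval t.
Proof. by []. Qed.

Lemma path_mul (k : fieldType) n (g h : 'M[k]_n) :
  path_to1 g -> path_to1 h -> path_to1 (g *m h).
Proof.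
move=> [G [dG G0 G1]] [H [dH H0 H1]]; exists (G *m H).
rewrite !evTE in G0 G1 H0 H1 *.
by rewrite det_mulmx dG dH !map_mxM G0 G1 H0 H1 mulmx1 mulr1.
Qed.

Lemma path_block (k : fieldType) m n (g : 'M[k]_n) :
  path_to1 g -> path_to1 (block_mx (1%:M : 'M_m) 0 0 g).
Proof.
move=> [G [dG G0 G1]]; exists (block_mx 1%:M 0 0 G).
rewrite !evTE in G0 G1 *.
by rewrite det_block_diag det1 dG !map_block_mx !map_mx1 !map_mx0 G0 G1 -scalar_mx_block mulr1.
Qed.

Lemma path_ublock (k : fieldType) m n (B : 'M[k]_(m, n)) :
  path_to1 (block_mx 1%:M B 0 1%:M).
Proof.
exists (block_mx 1%:M ('X *: map_mx polyC B) 0 1%:M).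
have E t : map_mx (evT t) ('X *: map_mx polyC B) = t *: B.
  by apply/matrixP=> i j; rewrite !mxE /evT !hornerE.
rewrite det_ublock !det1 mulr1 !map_block_mx !E !evTE !map_mx1 !map_mx0.
by rewrite scale0r scale1r -scalar_mx_block.
Qed.

Lemma path_lblock (k : fieldType) m n (B : 'M[k]_(n, m)) :
  path_to1 (block_mx 1%:M 0 B 1%:M).
Proof.
exists (block_mx 1%:M 0 ('X *: map_mx polyC B) 1%:M).
have E t : map_mx (evT t) ('X *: map_mx polyC B) = t *: B.
  by apply/matrixP=> i j; rewrite !mxE /evT !hornerE.
rewrite det_lblock !det1 mulr1 !map_block_mx !E !evTE !map_mx1 !map_mx0.
by rewrite scale0r scale1r -scalar_mx_block.
Qed.

Lemma path_cancel_ublock (k : fieldType) m n (g : 'M[k]_(m + n)) B :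
  path_to1 (g *m block_mx 1%:M B 0 1%:M) -> path_to1 g.
Proof.
move=> /path_mul /(_ (path_ublock (- B))); rewrite -mulmxA mulmx_block.
by rewrite !(mul0mx, mulmx0, mul1mx, mulmx1, addr0, add0r) addNr -scalar_mx_block mulmx1.
Qed.

Lemma path_cancel_lblock (k : fieldType) m n (g : 'M[k]_(m + n)) B :
  path_to1 (g *m block_mx 1%:M 0 B 1%:M) -> path_to1 g.
Proof.
move=> /path_mul /(_ (path_lblock (- B))); rewrite -mulmxA mulmx_block.
by rewrite !(mul0mx, mulmx0, mul1mx, mulmx1, addr0, add0r) subrr -scalar_mx_block mulmx1.
Qed.

(** Elementary block matrices are joined to the identity by scaling their off-diagonal block, so
    multiplying by them is free. They produce a nonzero entry off the corner in the first row, then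
    a corner equal to 1, then a first row cleared of everything else; what remains is a lower
    unitriangular matrix times an element of SL of one size less. *)
Lemma SL_path (k : fieldType) n (g : 'M[k]_n) : \det g = 1 -> path_to1 g.
Proof.
elim: n g => [|n IH] g dg.
  by exists 1%:M; rewrite det1 !evTE !map_mx1; split=> //; rewrite !thinmx0.
case: n IH g dg => [|n] IH.
  move=> g; rewrite det_mx11 => g1; exists 1%:M; rewrite det1 !evTE !map_mx1; split=> //.
  by rewrite [g]mx11_scalar g1.
suff nz (g : 'M[k]_(1 + n.+1)) : \det g = 1 -> ursubmx g != 0 -> path_to1 g.
  move=> g dg; have [r0|] := eqVneq (ursubmx (g : 'M_(1 + n.+1))) 0; last exact: nz.
  apply: (@path_cancel_ublock _ 1 n.+1 _ (delta_mx 0 0)); apply: nz.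
    by rewrite det_mulmx dg det_ublock !det1 !mulr1.
  rewrite -[g in g *m _](submxK (g : 'M_(1 + n.+1))) mulmx_block block_mxKur.
  rewrite r0 mul0mx addr0; apply/eqP=> /matrixP /(_ 0 0).
  rewrite [ulsubmx _]mx11_scalar mul_scalar_mx !mxE mulr1 => g0.
  have := det_lblock (ulsubmx (g : 'M_(1 + n.+1))) (dlsubmx (g : 'M_(1 + n.+1)))
    (drsubmx (g : 'M_(1 + n.+1))).
  rewrite -[X in block_mx _ X]r0 submxK dg det_mx11 !mxE g0 mul0r => /eqP.
  by rewrite oner_eq0.
move=> dg r0.
suff u1 (h : 'M[k]_(1 + n.+1)) : \det h = 1 -> ulsubmx h = 1%:M -> path_to1 h.
  have [j rj] : exists j, ursubmx g 0 j != 0.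
    by apply/existsP; apply: contraNT r0 => /existsPn r0; apply/eqP/rowP=> j;
       rewrite [RHS]mxE; apply/eqP/negPn/r0.
  apply: (@path_cancel_lblock _ 1 n.+1 _
    (((1 - ulsubmx g 0 0) / ursubmx g 0 j) *: delta_mx j 0)); apply: u1.
    by rewrite det_mulmx dg det_lblock !det1 !mulr1.
  rewrite -[g in g *m _]submxK mulmx_block block_mxKul mulmx1 -scalemxAr.
  rewrite -colE [LHS]mx11_scalar; congr (_%:M).
  by rewrite mxE [X in _ + X]mxE [X in _ + _ * X]mxE divfK // addrCA subrr addr0.
move=> dh uh; apply: (@path_cancel_ublock _ 1 n.+1 _ (- ursubmx h)).
rewrite -[h in h *m _]submxK mulmx_block uh !(mulmx1, mul1mx, mulmx0, addr0) addNr.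
set h' := _ + drsubmx h.
rewrite (_ : block_mx _ _ _ _ = block_mx 1%:M 0 (dlsubmx h) 1%:M *m block_mx 1%:M 0 0 h').
  apply: path_mul; [exact: path_lblock | apply/path_block/IH].
  have : \det (h *m block_mx 1%:M (- ursubmx h) 0 1%:M) = 1.
    by rewrite det_mulmx dh det_ublock !det1 !mulr1.
  rewrite -[h in h *m _]submxK mulmx_block uh !(mulmx1, mul1mx, mulmx0, addr0) addNr.
  by rewrite det_lblock det1 mul1r.
by rewrite mulmx_block !(mulmx1, mul1mx, mulmx0, mul0mx, addr0, add0r).
Qed.

(** * Reduction of unimodular forms over k[T] *)

Lemma schur_entry (R : comNzRingType) n q (X : 'M[R]_n.+1) (Y : 'rV_n.+1) :
  (q *: X - Y^T *m Y) 0 0 = q * X 0 0 - Y 0 0 ^+ 2.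
Proof. by rewrite !mxE big_ord1 !mxE. Qed.

Lemma ulsubmx2_block (R : nzRingType) n (q : R) (r : 'rV_n.+1) (N : 'M_n.+1) :
  ulsubmx (block_mx q%:M r r^T N : 'M_(2 + n)) =
  mat2 q (r 0 0) (r 0 0) (N 0 0).
Proof.
rewrite ulsubmx2; congr mat2.
- have := block_mxEul q%:M r r^T N 0 0; rewrite [in RHS]mxE eqxx mulr1n.
  by apply: etrans; congr (_ _ _); apply: val_inj.
- have := block_mxEur q%:M r r^T N 0 0.
  by apply: etrans; congr (_ _ _); apply: val_inj.
- have := block_mxEdl q%:M r r^T N 0 0; rewrite [in RHS]mxE.
  by apply: etrans; congr (_ _ _); apply: val_inj.
- have := block_mxEdr q%:M r r^T N 0 0.
  by apply: etrans; congr (_ _ _); apply: val_inj.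
Qed.

(* Hermite's bound, by reduction of the first basis vector [e]: a short vector of the
   form q(e) q - b(e, .)^2 induced on the quotient by [e] is lifted, made
   small against [e] by Euclidean division, and replaces [e] if it is shorter. *)
Lemma hermite (k : fieldType) n (H : 'M[{poly k}]_n.+1) :
  H^T = H -> \det H != 0 ->
  exists g, \det g = 1 /\
    (n.+1 * (size (cg g H 0 0)%R).-1 <= (size (\det H)%R).-1)%N.
Proof.
elim: n H => [|n IH] H sH dH.
  by exists 1%:M; rewrite det1 cg1 det_mx11 mul1n.
move: {2}(size _) (leqnn (size (H 0 0))) => s; elim: s H sH dH => [|s IHs] H sH dH.
  rewrite leqn0 => /eqP s0; exists 1%:M; rewrite det1 cg1; split=> //.
  by rewrite s0 muln0.
move=> ls; have [q0|q0] := eqVneq (H 0 0) 0.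
  exists 1%:M; rewrite det1 cg1; split=> //.
  by rewrite q0 size_poly0 muln0.
set q := H 0 0 in ls q0.
pose r := ursubmx (H : 'M_(1 + n.+1)); pose N := drsubmx (H : 'M_(1 + n.+1)).
have EH : H = block_mx q%:M r r^T N.
  have <- : ulsubmx (H : 'M_(1 + n.+1)) = q%:M.
    by rewrite [LHS]mx11_scalar !mxE; congr (_%:M); congr (H _ _); apply: val_inj.
  by rewrite -[LHS](submxK (H : 'M_(1 + n.+1))) /r trmx_ursub sH.
have sN : N^T = N by rewrite /N trmx_drsub sH.
pose K := q *: N - r^T *m r.
have sK : K^T = K by rewrite /K raddfB /= linearZ /= sN trmx_mul trmxK.
(* [K] is q times the Schur complement of the corner; the scaling avoids division by q. *)
have dK : q ^+ n * \det H = \det K.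
  pose L := block_mx 1%:M 0 (- r^T) q%:M : 'M_(1 + n.+1).
  have dL : \det L = q ^+ n.+1 by rewrite /L det_lblock det1 det_scalar mul1r.
  have dLH : \det (L *m H) = q * \det K.
    have -> : L *m H = (block_mx q%:M r 0 K : 'M_(1 + n.+1)).
      transitivity (L *m (block_mx q%:M r r^T N : 'M_(1 + n.+1))); first by rewrite -EH.
      rewrite mulmx_block !(mul1mx, mul0mx, addr0) mul_mx_scalar mul_scalar_mx.
      by rewrite scalerN addNr mul_scalar_mx mulNmx addrC.
    have -> : \det (block_mx q%:M r 0 K : 'M_(1 + n.+1)) = q * \det K => //.
    by rewrite det_ublock det_scalar1.
  by apply: (mulfI q0); rewrite -dLH det_mulmx dL exprS mulrA.
have [|g' [dg' lK]] := IH K sK.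
  by rewrite -dK mulf_neq0 // expf_neq0.
pose h := block_mx 1%:M 0 0 g' : 'M_(1 + n.+1).
have dh : \det h = 1 by rewrite /h det_block_diag det1 mul1r.
pose rg := r *m g'; pose b := rg 0 0; pose c := (cg g' N) 0 0.
have EH1 : cg h H = block_mx q%:M rg rg^T (cg g' N).
  transitivity (cg h (block_mx q%:M r r^T N : 'M_(1 + n.+1))); first by rewrite -EH.
  rewrite /h cg_block_diag trmx1 mul1mx mulmx1 -trmx_mul.
  by rewrite /cg trmx1 mul1mx mulmx1.
have EK00 : (cg g' K) 0 0 = q * c - b ^+ 2.
  have -> : cg g' K = q *: cg g' N - rg^T *m rg.
    by rewrite /cg /K mulmxBr mulmxBl -scalemxAr -scalemxAl /rg trmx_mul !mulmxA.
  exact: schur_entry.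
(* The second basis vector lifts a short vector of [K]. Subtracting [t] times the first one leaves
   the pairing [e], of degree less than q, and q times the value of the new vector is the value of
   [K] plus [e ^+ 2]. *)
pose t := b %/ q; pose e := b %% q.
have Eb : b = t * q + e by exact: divp_eq.
pose z := block_mx (mat2 (- t) (- 1) 1 0) 0 0 1%:M : 'M[{poly k}]_(2 + n).
have dz : \det z = 1.
  by rewrite /z det_block_diag det1 mulr1 det_mat2; ring.
pose H2 := cg z (cg h H) : 'M_n.+2.
have ul1 : ulsubmx (cg h H : 'M_(2 + n)) = mat2 q b b c.
  by rewrite EH1 ulsubmx2_block.
have EH2 : H2 0 0 = t ^+ 2 * q - t * b *+ 2 + c.
  have EH2 : H2 = block_mx (cg (mat2 (- t) (- 1) 1 0) (mat2 q b b c))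
      ((mat2 (- t) (- 1) 1 0)^T *m ursubmx (cg h H : 'M_(2 + n)))
      (dlsubmx (cg h H : 'M_(2 + n)) *m mat2 (- t) (- 1) 1 0)
      (drsubmx (cg h H : 'M_(2 + n))) :> 'M_(2 + n).
    rewrite /H2 -{1}(submxK (cg h H : 'M_(2 + n))) /z cg_block_diag ul1.
    by rewrite /cg !trmx1 !mul1mx !mulmx1.
  rewrite (@corner _ 1 n H2).
  by rewrite EH2 block_mxKul /cg tr_mat2 !mul_mat2 mxE /=; ring.
have Eq : q * H2 0 0 = cg g' K 0 0 + e ^+ 2.
  by rewrite EH2 EK00 Eb; ring.
have [lt|ge] := ltnP (size (H2 0 0)) (size q).
  have [|||g2 [dg2 l2]] := IHs H2.
  - by apply: cg_sym; apply: cg_sym.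
  - by rewrite /H2 !det_cg1.
  - by rewrite -ltnS (leq_trans lt).
  exists (h *m z *m g2); split; first by rewrite !det_mulmx dh dz dg2 !mulr1.
  by rewrite !cg_mul; move: l2; rewrite /H2 !det_cg1.
(* If the new vector is not shorter, [e ^+ 2] has smaller degree than [q * H2 0 0], so the value of
   [K] has degree at least 2 deg q. By induction 2 (n+1) deg q <= deg det K = n deg q + deg det H,
   that is (n+2) deg q <= deg det H. *)
exists 1%:M; rewrite det1 cg1; split=> //; rewrite -/q.
have q1 : (0 < size q)%N by rewrite size_poly_gt0.
have H20 : H2 0 0 != 0 by rewrite -size_poly_gt0 (leq_trans q1).
have sE : size (q * H2 0 0) = (size q + size (H2 0 0)).-1 by rewrite size_mul.
have se : (size (e ^+ 2)%R < size (q * H2 0 0)%R)%N.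
  have le : (size e < size q)%N by rewrite ltn_modp.
  have := size_mul_le (leqnn (size e)) (leqnn (size e)); rewrite -expr2 sE.
  move: (size (e ^+ 2)) (size e) (size q) (size (H2 0 0)) le q1 ge; clear; lia.
have sK00 : size (cg g' K 0 0) = (size q + size (H2 0 0)).-1.
  have -> : cg g' K 0 0 = q * H2 0 0 - e ^+ 2 by rewrite Eq addrK.
  by rewrite size_polyDl ?size_polyN.
have sdK : (size (\det K)).-1 = (n * (size q).-1 + (size (\det H)).-1)%N.
  rewrite -dK size_mul ?expf_neq0 // [(n * _)%N]mulnC -size_exp.
  have : (0 < size (q ^+ n))%N by rewrite size_poly_gt0 expf_neq0.
  have : (0 < size (\det H))%N by rewrite size_poly_gt0.
  move: (size (q ^+ n)) (size (\det H)); clear; lia.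
move: lK; rewrite sdK sK00.
move: (size q) (size (H2 0 0)) (size (\det H)) q1 ge => [//|a] [//|b'] D _ /=.
rewrite ltnS addnS /= => ab.
suff : (n.+1 * (a + a) <= n.+1 * (a + b'))%N by lia.
by rewrite leq_mul2l leq_add2l ab orbT.
Qed.

(** Since det H is a nonzero constant, Hermite's bound makes the value of some first basis vector a
    constant. If it is nonzero, a line splits off; if it is zero, the vector is isotropic and lies
    in a plane whose unit c is again a constant, while p stays an arbitrary polynomial. *)
Lemma unimodular_split (k : fieldType) n (H : 'M[{poly k}]_n.+1) : symnd_pt H ->
  exists g, \det g = 1 /\
  ((exists u N, u != 0 /\ cg g H = block_mx (u%:P)%:M 0 0 N :> 'M_(1 + n)) \/
   (match n return 'M[{poly k}]_n.+1 -> Prop with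
    | 0 => fun=> False
    | n'.+1 => fun M => exists c p N,
        c != 0 /\ M = block_mx (mat2 0 c%:P c%:P p) 0 0 N :> 'M_(2 + n')
    end (cg g H))).
Proof.
move=> [sH uH]; have unitP (p : {poly k}) : p \is a GRing.unit -> exists2 u, u != 0 & p = u%:P.
  rewrite poly_unitE => /andP[/eqP s1 u0]; exists p`_0; first by rewrite -unitfE.
  by rewrite [LHS]size1_polyC ?s1.
have [u u0 Eu] := unitP _ uH.
have [|g [dg]] := hermite sH; first by rewrite Eu polyC_eq0.
rewrite Eu size_polyC u0 leqn0 muln_eq0 /= => /eqP s1.
have [sH1 uH1] := symnd_cg dg (conj sH uH).
have EH : cg g H 0 0 = ((cg g H 0 0)`_0)%:P.
  by apply: size1_polyC; move: s1; case: (size _) => [|[]].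
move: EH; set v := _`_0 => EH; have [v0|v0] := eqVneq v 0; last first.
  have [|h [N [dh _ Eh]]] := cg_unit_corner sH1.
    by rewrite EH poly_unitE size_polyC v0 coefC /= unitfE.
  exists (g *m h); rewrite det_mulmx dg dh mulr1; split=> //.
  by left; exists v, N; rewrite cg_mul Eh -EH.
rewrite v0 in EH.
case: n H sH uH Eu g dg s1 sH1 uH1 v EH v0 => [|n] H sH uH Eu g dg s1 sH1 uH1 v EH v0.
  by move: uH1; rewrite det_mx11 EH unitr0.
have [h [c [p [N [dh _ uc E]]]]] := cg_isotropic (@poly_bezout_ring k) sH1 uH1 EH.
have [c' c0 Ec] := unitP _ uc.
exists (g *m h); rewrite det_mulmx dg dh mulr1; split=> //.
by right; exists c', p, N; rewrite cg_mul E Ec.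
Qed.

(** * Splittings over k and their constancy along homotopies *)

(* [dec M us]: up to volume-preserving changes of basis, [M] is an orthogonal sum
   of lines [<u>], contributing [u], and of metabolic planes [[0, c], [c, p]],
   contributing [1] and [- c ^+ 2] (the plane with [p = 1] is
   [<1> + <- c ^+ 2>]). *)
Fixpoint dec (k : fieldType) n : 'M[k]_n -> seq k -> Prop :=
  match n with
  | 0 => fun _ us => us = [::]
  | m.+1 => fun M us =>
    (exists g u (N : 'M_m) us', [/\ \det g = 1, u != 0,
       cg g M = block_mx u%:M 0 0 N :> 'M_(1 + m), dec N us' & us = u :: us'])
    \/
    (match m return 'M_m.+1 -> Prop with
     | 0 => fun=> False
     | m'.+1 => fun M => exists g c p (N : 'M_m') us', [/\ \det g = 1, c != 0,
       cg g M = block_mx (mat2 0 c c p) 0 0 N :> 'M_(2 + m'), dec N us'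
       & us = 1 :: - c ^+ 2 :: us']
     end M)
  end.

Lemma dec_line (k : fieldType) n (g M : 'M[k]_n.+1) u N us :
  \det g = 1 -> u != 0 -> cg g M = block_mx u%:M 0 0 N :> 'M_(1 + n) ->
  dec N us -> dec M (u :: us).
Proof. by move=> dg u0 E d; left; exists g, u, N, us. Qed.

Lemma dec_plane (k : fieldType) n (g M : 'M[k]_n.+2) c p N us :
  \det g = 1 -> c != 0 -> cg g M = block_mx (mat2 0 c c p) 0 0 N :> 'M_(2 + n) ->
  dec N us -> dec M (1 :: - c ^+ 2 :: us).
Proof. by move=> dg u0 E d; right; exists g, c, p, N, us. Qed.

Lemma dec_cg (k : fieldType) n (g M : 'M[k]_n) us :
  \det g = 1 -> dec M us -> dec (cg g M) us.
Proof.
case: n g M => [|n] g M dg //.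
have dgi : \det (invmx g) = 1 by exact: det1_inv.
have Eg h : cg (invmx g *m h) (cg g M) = cg h M.
  by rewrite -cg_mul mulmxA mulmxV ?mul1mx // det1_unit.
case=> [[h [u [N [us' [dh u0 E d ->]]]]]|].
  by apply: (@dec_line _ _ (invmx g *m h) _ _ N); rewrite ?det_mulmx ?dgi ?dh ?mulr1 ?Eg.
case: n g M dg dgi Eg => [//|n] g M dg dgi Eg [h [c [p [N [us' [dh c0 E d ->]]]]]].
by apply: (@dec_plane _ _ (invmx g *m h) _ c p N); rewrite ?det_mulmx ?dgi ?dh ?mulr1 ?Eg.
Qed.

Lemma symnd_map (R S : comUnitRingType) (f : {rmorphism R -> S}) n (M : 'M[R]_n) :
  symnd_pt M -> symnd_pt (map_mx f M).
Proof.
move=> [sM uM]; split; first by rewrite map_trmx sM.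
by rewrite det_map_mx rmorph_unit.
Qed.

Lemma symnd_block (R : comUnitRingType) m n (A : 'M[R]_m) (N : 'M[R]_n) :
  symnd_pt (block_mx A 0 0 N) -> symnd_pt N.
Proof.
move=> [+ +]; rewrite tr_block_mx !trmx0 det_block_diag unitrM.
by move=> /eq_block_mx[_ _ _ sN] /andP[].
Qed.

(* Along a homotopy, a unimodular splitting has constant entries [u] and [c]; only
   the entries [p], which [dec] ignores, vary with [t]. *)
Lemma dec_htp (k : fieldType) n (H : 'M[{poly k}]_n) : symnd_pt H ->
  exists us, forall t, dec (map_mx (evT t) H) us.
Proof.
elim/ltn_ind: n H => -[|n] IH H sH; first by exists [::].
have evC (u t : k) : evT t u%:P = u by rewrite /evT hornerC.
have [g [dg [[u [N [u0 E]]]|]]] := unimodular_split sH.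
  have [us dus] : exists us, forall t, dec (map_mx (evT t) N) us.
    by apply: IH => //; apply: (@symnd_block _ 1 n (u%:P)%:M); rewrite -E; apply: symnd_cg.
  exists (u :: us) => t; apply: (dec_line _ u0 _ (dus t)).
    have : \det (map_mx (evT t) g) = 1 by rewrite evTE det_map_mx dg rmorph1.
    by apply.
  rewrite !evTE -map_cg E.
  transitivity (map_mx (horner_eval t) (block_mx (u%:P)%:M 0 0 N : 'M_(1 + n))) => //.
  rewrite map_block_mx !map_mx0 map_scalar_mx /=.
  by congr (block_mx (_%:M) _ _ _); exact: evC.
case: n IH H sH g dg => [//|n] IH H sH g dg [c [p [N [c0 E]]]].
have [us dus] : exists us, forall t, dec (map_mx (evT t) N) us.
  by apply: IH => //; apply: (@symnd_block _ 2 n (mat2 0 c%:P c%:P p)); rewrite -E; apply: symnd_cg.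
exists (1 :: - c ^+ 2 :: us) => t.
apply: (@dec_plane _ _ (map_mx (evT t) g) _ c (evT t p) _ _ _ c0 _ (dus t)).
  by rewrite evTE det_map_mx dg rmorph1.
rewrite !evTE -map_cg E.
transitivity (map_mx (horner_eval t)
  (block_mx (mat2 0 c%:P c%:P p) 0 0 N : 'M_(2 + n))) => //.
rewrite map_block_mx !map_mx0 map_mat2 /=.
by congr (block_mx (mat2 _ _ _ _) _ _ _); [exact: horner0 | exact: evC | exact: evC].
Qed.

Lemma dec_exists (k : fieldType) n (M : 'M[k]_n) : symnd_pt M -> exists us, dec M us.
Proof.
move=> /(symnd_map polyC) /dec_htp [us /(_ 0)]; exists us.
rewrite (_ : M = map_mx (evT 0) (map_mx polyC M)) //.
by apply/matrixP=> i j; rewrite !mxE /evT hornerC.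
Qed.

Lemma dec_nz (k : fieldType) n (M : 'M[k]_n) us : dec M us ->
  all (fun u => u != 0) us /\ size us = n.
Proof.
elim/ltn_ind: n M us => -[|n] IH M us; first by move=> /= ->.
case=> [[h [u [N [us' [dh u0 E d ->]]]]]|].
  by have [//|a s] := IH n _ N us' d; rewrite /= u0 a s.
case: n IH M => [//|n] IH M [h [c [p [N [us' [dh c0 E d ->]]]]]].
have [|a s] := IH n _ N us' d; first exact: leqW.
by rewrite /= oner_eq0 oppr_eq0 sqrf_eq0 c0 a s.
Qed.

(** * Uniqueness of splittings *)

Definition mat3 (R : nzRingType) (a b c d e f g h i : R) : 'M[R]_3 :=
  \matrix_(r, s) nth 0 (nth [::] [:: [:: a; b; c]; [:: d; e; f]; [:: g; h; i]] r) s.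

Lemma mul_mat3 (R : nzRingType) (a b c d e f g h i a' b' c' d' e' f' g' h' i' : R) :
  mat3 a b c d e f g h i *m mat3 a' b' c' d' e' f' g' h' i' =
  mat3 (a * a' + b * d' + c * g') (a * b' + b * e' + c * h') (a * c' + b * f' + c * i')
       (d * a' + e * d' + f * g') (d * b' + e * e' + f * h') (d * c' + e * f' + f * i')
       (g * a' + h * d' + i * g') (g * b' + h * e' + i * h') (g * c' + h * f' + i * i').
Proof.
apply/matrixP=> r s; rewrite !mxE !big_ord_recl big_ord0 addr0 !mxE /=.
by case: r => [[|[|[|[]]]] ?] //; case: s => [[|[|[|[]]]] ?] //=; rewrite addrA.
Qed.

Lemma tr_mat3 (R : nzRingType) (a b c d e f g h i : R) :
  (mat3 a b c d e f g h i)^T = mat3 a d g b e h c f i.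
Proof.
by apply/matrixP=> r s; rewrite !mxE;
   case: r => [[|[|[|[]]]] ?] //; case: s => [[|[|[|[]]]] ?].
Qed.

Lemma det_mat3 (R : comNzRingType) (a b c d e f g h i : R) :
  \det (mat3 a b c d e f g h i) =
  a * (e * i - f * h) - b * (d * i - f * g) + c * (d * h - e * g).
Proof.
rewrite (expand_det_row _ ord0) !big_ord_recl big_ord0 /cofactor.
rewrite !(expand_det_row _ ord0) !big_ord_recl !big_ord0 /cofactor.
rewrite !det_mx11 !mxE /= /bump /=; ring.
Qed.

Lemma mat3_ul (R : nzRingType) (a b c d u : R) :
  block_mx (mat2 a b c d) 0 0 u%:M = mat3 a b 0 c d 0 0 0 u :> 'M_(2 + 1).
Proof.
apply/matrixP=> r s; rewrite !mxE; case: splitP => i Ei; rewrite !mxE;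
  case: splitP => j Ej; rewrite !mxE Ei Ej.
- by case: i {Ei} => [[|[|[]]] ?] //; case: j {Ej} => [[|[|[]]] ?].
- by rewrite ord1; case: i {Ei} => [[|[|[]]] ?].
- by rewrite ord1; case: j {Ej} => [[|[|[]]] ?].
- by rewrite !ord1 eqxx mulr1n.
Qed.

Lemma mat3_dr (R : nzRingType) (a b c d u : R) :
  block_mx u%:M 0 0 (mat2 a b c d) = mat3 u 0 0 0 a b 0 c d :> 'M_(1 + 2).
Proof.
apply/matrixP=> r s; rewrite !mxE; case: splitP => i Ei; rewrite !mxE;
  case: splitP => j Ej; rewrite !mxE Ei Ej.
- by rewrite !ord1 eqxx mulr1n.
- by rewrite ord1; case: j {Ej} => [[|[|[]]] ?].
- by rewrite ord1; case: i {Ei} => [[|[|[]]] ?].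
- by case: i {Ei} => [[|[|[]]] ?] //; case: j {Ej} => [[|[|[]]] ?].
Qed.

Lemma mat2_block (R : nzRingType) (u v : R) :
  block_mx u%:M 0 0 v%:M = mat2 u 0 0 v :> 'M_(1 + 1).
Proof.
apply/matrixP=> r s; rewrite !mxE; case: splitP => i Ei; rewrite !mxE;
  case: splitP => j Ej; rewrite !mxE; move: Ei Ej; rewrite ?ord1 => Ei Ej;
  rewrite -!val_eqE /= Ei Ej //.
Qed.

Lemma block_diagA (R : nzRingType) l m n (A : 'M[R]_l) (B : 'M_m) (C : 'M_n) :
  block_mx A 0 0 (block_mx B 0 0 C) =
  castmx (esym (addnA l m n), esym (addnA l m n)) (block_mx (block_mx A 0 0 B) 0 0 C).
Proof.
have := @block_mxA R l m n l m n A 0 0 0 B 0 0 0 C.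
by rewrite /= !row_mx0 !col_mx0.
Qed.

Lemma block_112 (R : nzRingType) n (u v : R) (N : 'M_n) :
  block_mx (u%:M : 'M_1) 0 0 (block_mx (v%:M : 'M_1) 0 0 N) =
  block_mx (mat2 u 0 0 v) 0 0 N :> 'M_(2 + n).
Proof.
by rewrite -mat2_block; have := block_diagA (u%:M : 'M_1) (v%:M : 'M_1) N;
   rewrite castmx_id.
Qed.

Lemma block_123 (R : nzRingType) n (u : R) (P : 'M_2) (N : 'M_n) :
  block_mx (u%:M : 'M_1) 0 0 (block_mx P 0 0 N) =
  block_mx (block_mx u%:M 0 0 P : 'M_(1 + 2)) 0 0 N :> 'M_(3 + n).
Proof.
by have := block_diagA (u%:M : 'M_1) P N; rewrite castmx_id.
Qed.

Lemma block_213 (R : nzRingType) n (u : R) (P : 'M_2) (N : 'M_n) :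
  block_mx P 0 0 (block_mx (u%:M : 'M_1) 0 0 N) =
  block_mx (block_mx P 0 0 u%:M : 'M_(2 + 1)) 0 0 N :> 'M_(3 + n).
Proof.
by have := block_diagA P (u%:M : 'M_1) N; rewrite castmx_id.
Qed.

Lemma cg_diag (R : comNzRingType) m n (g A : 'M[R]_m) (h N : 'M[R]_n) :
  cg (block_mx g 0 0 h) (block_mx A 0 0 N) = block_mx (cg g A) 0 0 (cg h N).
Proof. by rewrite cg_block_diag !mulmx0 !mul0mx. Qed.

Lemma line_corner (R : nzRingType) n (v : R) (A : 'M_(1, n)) B (N : 'M_n) :
  block_mx (v%:M : 'M_1) A B N 0 0 = v.
Proof. by rewrite (@corner _ 0 n) block_mxKul mxE eqxx. Qed.

(** Allows an explicit change of the first few basis vectors to be compared with a vector a e + l f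
    given by its components on a line and on the complement. *)
Lemma block_e1 (R : nzRingType) m n a l (Z : 'M[R]_m.+2) :
  Z 0 0 = a -> Z 1 0 = l -> (forall i : 'I_m.+2, (1 < i)%N -> Z i 0 = 0) ->
  block_mx Z 0 0 1%:M *m (delta_mx 0 0 : 'cV_(m.+2 + n)) =
  col_mx a%:M (l *: delta_mx 0 0) :> 'cV_(1 + (m.+1 + n)).
Proof.
move=> Za Zl Z0; rewrite -colE; apply/colP=> i; rewrite !mxE.
have -> : (0 : 'I_(m.+2 + n)) = lshift n 0 by exact: val_inj.
case: splitP => j Ej; case: splitP => j' Ej'; rewrite ?row_mxEl.
- rewrite (ord1 j') mxE eqxx mulr1n -Za; congr (Z _ _); apply: val_inj.
  by rewrite /= -Ej Ej' ord1.
- have Ejj : j = j'.+1 :> nat by rewrite -Ej Ej'.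
  rewrite !mxE andbT; case: (eqVneq j' 0) => [j0|j0].
    by rewrite mulr1 -Zl; congr (Z _ _); apply: val_inj; rewrite /= Ejj j0.
  by rewrite mulr0 Z0 // Ejj ltnS lt0n.
- by move: Ej; rewrite Ej' ord1.
- rewrite !mxE (_ : (j' == 0) = false) ?mulr0 //; apply/negP=> /eqP j0.
  by move: Ej; rewrite Ej' j0.
Qed.

(* Relations between the classes of the sums X / u_1 (+) ... (+) X / u_n. *)
Inductive leqs (k : fieldType) : seq k -> seq k -> Prop :=
| leqs_refl us : leqs us us
| leqs_sym us vs : leqs us vs -> leqs vs us
| leqs_trans vs us ws : leqs us vs -> leqs vs ws -> leqs us ws
| leqs_cons u us vs : u != 0 -> leqs us vs -> leqs (u :: us) (u :: vs)
| leqs_pair a l u v us : u != 0 -> v != 0 -> a ^+ 2 * u + l ^+ 2 * v != 0 ->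
    let b := a ^+ 2 * u + l ^+ 2 * v in
    leqs (u :: v :: us) (b :: u * v / b :: us)
| leqs_plane p c us : p != 0 -> c != 0 ->
    leqs (p :: - c ^+ 2 / p :: us) (1 :: - c ^+ 2 :: us).

Lemma leqs_swap (k : fieldType) (u v : k) us : u != 0 -> v != 0 ->
  leqs (u :: v :: us) (v :: u :: us).
Proof.
move=> u0 v0; have E : 0 ^+ 2 * u + 1 ^+ 2 * v = v by ring.
by have := @leqs_pair k 0 1 u v us u0 v0; rewrite /= E mulfK //; apply.
Qed.

Lemma leqs_square (k : fieldType) (u v c : k) us : u != 0 -> v != 0 -> c != 0 ->
  leqs (u * c ^+ 2 :: v :: us) (u :: v * c ^+ 2 :: us).
Proof.
move=> u0 v0 c0; have E : (c^-1) ^+ 2 * (u * c ^+ 2) + 0 ^+ 2 * v = u by field.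
have := @leqs_pair k c^-1 0 (u * c ^+ 2) v us; rewrite /= E.
rewrite (_ : u * c ^+ 2 * v / u = v * c ^+ 2); last by field.
by apply=> //; rewrite mulf_neq0 ?expf_neq0.
Qed.

Definition qf (R : nzRingType) n (M : 'M[R]_n) (x : 'cV_n) : R := (x^T *m M *m x) 0 0.

Lemma qf_cg (R : comNzRingType) n (g M : 'M[R]_n) x : qf (cg g M) x = qf M (g *m x).
Proof. by rewrite /qf /cg trmx_mul !mulmxA. Qed.

Lemma qf_block (R : nzRingType) m n (A : 'M[R]_m) (N : 'M_n) x y :
  qf (block_mx A 0 0 N) (col_mx x y) = qf A x + qf N y.
Proof.
rewrite /qf tr_col_mx mul_row_block !mulmx0 addr0 add0r mul_row_col.
by rewrite mxE.
Qed.

Lemma qf_e1 (R : nzRingType) n (M : 'M[R]_n.+1) : qf M (delta_mx 0 0) = M 0 0.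
Proof. by rewrite /qf trmx_delta -rowE -colE !mxE. Qed.

Lemma qfZ (R : comNzRingType) n (M : 'M[R]_n) a x : qf M (a *: x) = a ^+ 2 * qf M x.
Proof.
rewrite /qf [(a *: x)^T]linearZ /= -scalemxAr -!scalemxAl scalerA.
by rewrite [LHS]mxE expr2.
Qed.

Lemma qf_mat2 (R : comNzRingType) (a b c d : R) x :
  qf (mat2 a b c d) x =
  a * x 0 0 ^+ 2 + (b + c) * (x 0 0 * x 1 0) + d * x 1 0 ^+ 2.
Proof.
rewrite /qf !mxE !big_ord_recl big_ord0 !mxE !big_ord_recl !big_ord0 !mxE /=.
rewrite (_ : lift 0 0 = 1); last exact: val_inj.
ring.
Qed.

(* Two bases of the same volume with the same first vector [w]: the orthogonal
   complements of [w] are isometric by a volume-preserving map. *)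
Lemma cancel_line (k : fieldType) n (v : k) (N N' : 'M_n) (s z Q : 'M_(1 + n)) :
  v != 0 -> \det s = 1 -> \det z = 1 ->
  s *m delta_mx 0 0 = z *m delta_mx 0 0 :> 'cV_n.+1 ->
  cg z Q = block_mx v%:M 0 0 N -> cg s Q = block_mx v%:M 0 0 N' ->
  exists Y, \det Y = 1 /\ N' = cg Y N.
Proof.
move=> v0 ds dz sz Ez Es.
have uz : z \in unitmx by exact: det1_unit.
have [y [dy Ey ye]] : exists y : 'M_(1 + n), [/\ \det y = 1,
    cg y (block_mx v%:M 0 0 N) = block_mx v%:M 0 0 N'
    & y *m delta_mx 0 0 = delta_mx 0 0 :> 'cV_n.+1].
  exists (invmx z *m s); split; first by rewrite det_mulmx ds det1_inv ?mulr1.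
    by rewrite -Ez -Es -cg_mul mulKVmx.
  by rewrite -mulmxA sz mulKmx.
have [r [Y y1]] : exists r Y, y = block_mx 1%:M r 0 Y.
  have yc i : y i 0 = (i == 0)%:R.
    have := congr1 (fun w : 'cV_n.+1 => w i 0) ye; rewrite -colE !mxE.
    by rewrite andbT.
  exists (ursubmx y), (drsubmx y).
  rewrite -[LHS]submxK; congr (block_mx _ _ _ _).
    apply/matrixP=> i j; rewrite !mxE !ord1 (_ : lshift n 0 = 0); last exact: val_inj.
    by rewrite yc.
  apply/matrixP=> i j; rewrite !mxE !ord1 (_ : lshift n 0 = 0); last exact: val_inj.
  by rewrite yc.
have r0 : r = 0.
  move: Ey; rewrite y1 /cg tr_block_mx !trmx0 trmx1 !mulmx_block.
  rewrite !(mul1mx, mul0mx, mulmx1, mulmx0, addr0, add0r).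
  move/eq_block_mx => [_ + _ _]; rewrite mul_scalar_mx => /eqP.
  by rewrite scaler_eq0 (negPf v0) => /eqP.
exists Y; split; first by move: dy; rewrite y1 det_ublock det1 mul1r.
by move: Ey; rewrite y1 r0 cg_block_diag => /eq_block_mx[_ _ _ <-].
Qed.

Lemma corner_cg (R : comNzRingType) n (s z Q : 'M[R]_n.+1) :
  s *m delta_mx 0 0 = z *m delta_mx 0 0 :> 'cV_n.+1 ->
  (cg s Q) 0 0 = (cg z Q) 0 0.
Proof. by move=> E; rewrite -!qf_e1 !qf_cg E. Qed.

Lemma dec_block_line (k : fieldType) n u (N : 'M[k]_n) us : u != 0 -> dec N us ->
  @dec k n.+1 (block_mx (u%:M : 'M_1) 0 0 N) (u :: us).
Proof. by move=> u0 d; apply: (@dec_line _ _ 1%:M _ _ N) => //; rewrite ?det1 ?cg1. Qed.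

Lemma dec_block_plane (k : fieldType) n c p (N : 'M[k]_n) us : c != 0 -> dec N us ->
  @dec k n.+2 (block_mx (mat2 0 c c p) 0 0 N) (1 :: - c ^+ 2 :: us).
Proof. by move=> u0 d; apply: (@dec_plane _ _ 1%:M _ _ p N) => //; rewrite ?det1 ?cg1. Qed.

Lemma split_form_line (k : fieldType) n (M : 'M[k]_n.+1) : M 0 0 != 0 -> split_form M ->
  exists b N, b != 0 /\ M = block_mx b%:M 0 0 N :> 'M_(1 + n).
Proof.
move=> M0 [//|]; case: n M M0 => [//|n] M M0 [c [p [N [c0 E]]]].
by move: M0; rewrite (@corner _ 1 n M) E block_mxKul mxE /= eqxx.
Qed.

Definition dec_uniq_at (k : fieldType) n := forall (M : 'M[k]_n) us vs,
  symnd_pt M -> dec M us -> dec M vs -> leqs us vs.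

(* The first vectors e and w = a e + l f of the two decompositions span a plane
   together with f, where f can be completed to a decomposition of the complement of
   e. If f is anisotropic, only that plane changes; if f is isotropic, it lies
   in a metabolic plane orthogonal to e, and c is replaced by c / a. *)
Lemma leqs_line_line (k : fieldType) n (u v : k) (M N : 'M[k]_n) (s : 'M_(1 + n)) us vs :
  dec_uniq_at k n -> symnd_pt M -> symnd_pt N -> u != 0 -> v != 0 -> \det s = 1 ->
  cg s (block_mx u%:M 0 0 M) = block_mx v%:M 0 0 N ->
  dec M us -> dec N vs -> leqs (u :: us) (v :: vs).
Proof.
case: n M N s => [|n] M N s IH sM sN u0 v0 ds Es.
  move=> /= -> ->; have := congr1 determinant Es; rewrite det_cg1 //.
  by rewrite !det_block_diag !det_mx00 !mulr1 !det_scalar1 => ->; exact: leqs_refl.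
move=> dM dN.
pose x : 'cV_(1 + n.+1) := s *m delta_mx 0 0.
(* The component of w orthogonal to e is l f, with l = 0 when it vanishes. *)
have [t [l [dt Et St]]] := split_adapted (dsubmx x) sM.
pose a := x 0 0; pose h := block_mx 1%:M 0 0 t : 'M_(1 + n.+1).
have dh : \det h = 1 by rewrite /h det_block_diag det1 mul1r.
have uh : h \in unitmx by exact: det1_unit.
pose Q : 'M_(1 + n.+1) := block_mx u%:M 0 0 (cg t M).
have QE : Q = block_mx (u%:M : 'M_1) 0 0 (cg t M) by [].
have EQ : cg h (block_mx u%:M 0 0 M) = Q.
  by rewrite /h cg_diag cg1.
have [s' [ds' Es' se]] : exists s' : 'M_(1 + n.+1), [/\ \det s' = 1,
    cg s' Q = block_mx v%:M 0 0 N
    & s' *m delta_mx 0 0 = col_mx a%:M (l *: delta_mx 0 0) :> 'cV_(1 + n.+1)].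
  exists (invmx h *m s); split; first by rewrite det_mulmx det1_inv // ds mulr1.
    by rewrite -EQ -Es -cg_mul mulKVmx.
  have -> : invmx h *m s *m delta_mx 0 0 = invmx h *m x by rewrite mulmxA.
  rewrite (_ : x = h *m col_mx a%:M (l *: delta_mx 0 0)) ?mulKmx // /h mul_block_col !mul0mx addr0 add0r mul1mx.
  rewrite -scalemxAr -Et -[LHS]vsubmxK; congr col_mx.
  rewrite [LHS]mx11_scalar /a mxE; congr ((x _ _)%:M); exact: val_inj.
move: (a) se => {x Et} {}a se.
have vE : v = (cg s' Q) 0 0.
  by rewrite Es' line_corner.
case: St => [[b [M3 [b0 E3]]]|].
  have [us3 d3] : exists us3, dec M3 us3.
    apply: dec_exists; apply: (@symnd_block _ 1 n b%:M); rewrite -E3.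
    exact: symnd_cg.
  have EQ2 : Q = block_mx (mat2 u 0 0 b) 0 0 M3 :> 'M_(2 + n).
    by rewrite -block_112 -E3.
  have zE (e f : k) : block_mx (mat2 a e l f) 0 0 1%:M *m (delta_mx 0 0 : 'cV_(2 + n)) =
      s' *m delta_mx 0 0.
    rewrite se; apply: (@block_e1 _ 0 n); rewrite ?mxE //.
    by case=> [[|[|[]]] ?].
  have cgE e f : cg (block_mx (mat2 a e l f) 0 0 1%:M) Q =
      block_mx (cg (mat2 a e l f) (mat2 u 0 0 b)) 0 0 M3 :> 'M_(2 + n).
    by rewrite EQ2 cg_diag cg1.
  have vE2 : v = a ^+ 2 * u + l ^+ 2 * b.
    rewrite vE (corner_cg _ (esym (zE 0 0))) cgE (@corner _ 1 n) block_mxKul.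
    by rewrite /cg tr_mat2 !mul_mat2 mxE /=; ring.
  (* The second column is orthogonal to w = (a, l) in <u> + <b>, scaled so that the determinant is
     1; its value is then u b / v. *)
  pose z := block_mx (mat2 a (- l * b / v) l (a * u / v)) 0 0 1%:M : 'M_(2 + n).
  have dz : \det z = 1.
    rewrite /z det_block_diag det1 det_mat2 mulr1.
    have -> : a * (a * u / v) - - l * b / v * l = (a ^+ 2 * u + l ^+ 2 * b) / v by field.
    by rewrite -vE2 divff.
  have Ez : cg z Q = block_mx (v%:M : 'M_1) 0 0 (block_mx ((u * b / v)%:M : 'M_1) 0 0 M3).
    rewrite block_112 cgE; congr (block_mx _ _ _ _).
    rewrite /cg tr_mat2 !mul_mat2; congr mat2; try by field.
      by rewrite vE2; ring.
    by transitivity (u * b * (a ^+ 2 * u + l ^+ 2 * b) / v ^+ 2);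
      [field | rewrite -vE2; field].
  have [Y [dY EN]] := cancel_line v0 ds' dz (esym (zE _ _)) Ez Es'.
  have ub0 : u * b / v != 0 by rewrite !mulf_neq0 ?invr_eq0.
  have L1 : leqs us (b :: us3) by apply: (IH M) => //; apply: dec_line dt b0 E3 d3.
  have L2 : leqs (u * b / v :: us3) vs.
    by apply: (IH N) => //; rewrite EN; apply: dec_cg => //; apply: dec_block_line.
  apply: leqs_trans (leqs_cons u0 L1) _; apply: leqs_trans (leqs_cons v0 L2).
  by rewrite vE2; apply: leqs_pair => //; rewrite -vE2.
case: n M N s IH sM sN ds Es dM dN t dt h dh uh Q QE EQ s' ds' Es' se vE =>
  [//|n] M N s IH sM sN ds Es dM dN t dt h dh uh Q QE EQ s' ds' Es' se vE.
move=> [c [p [M3 [c0 E3]]]].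
have [us3 d3] : exists us3, dec M3 us3.
  apply: dec_exists; apply: (@symnd_block _ 2 n (mat2 0 c c p)); rewrite -E3.
  exact: symnd_cg.
pose S : 'M[k]_3 := mat3 u 0 0 0 0 c 0 c p.
have EQ2 : Q = block_mx S 0 0 M3 :> 'M_(3 + n).
  by rewrite /S -mat3_dr -block_123 -E3 QE.
pose Z b d e f : 'M[k]_3 := mat3 a b d l e f 0 0 1.
have zE b d e f : block_mx (Z b d e f) 0 0 1%:M *m (delta_mx 0 0 : 'cV_(3 + n)) =
    s' *m delta_mx 0 0.
  rewrite se; apply: (@block_e1 _ 1 n); rewrite ?mxE //.
  by case=> [[|[|[|[]]]] ?] //; rewrite mxE.
have cgE b d e f : cg (block_mx (Z b d e f) 0 0 1%:M) Q =
    block_mx (cg (Z b d e f) S) 0 0 M3 :> 'M_(3 + n).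
  by rewrite EQ2 cg_diag cg1.
have vE2 : v = a ^+ 2 * u.
  rewrite vE (corner_cg _ (esym (zE 0 0 0 0))) cgE (@corner _ 2 n) block_mxKul.
  by rewrite /cg tr_mat3 !mul_mat3 mxE /=; ring.
have a0 : a != 0 by apply: contraNneq v0 => a0; rewrite vE2 a0 expr0n mul0r.
(* The new basis is w, f / a, and the third vector minus its projection on w: the factor 1 / a
   restores volume 1 and turns c into c / a. *)
pose w := - (l * c) / v.
pose z := block_mx (Z 0 (w * a) a^-1 (w * l)) 0 0 1%:M : 'M_(3 + n).
have dz : \det z = 1.
  by rewrite /z det_block_diag det1 det_mat3 mulr1; field.
pose p' := p - (l * c) ^+ 2 / v.
have Ez : cg z Q = block_mx (v%:M : 'M_1) 0 0 (block_mx (mat2 0 (c / a) (c / a) p') 0 0 M3).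
  rewrite block_123 cgE mat3_dr; congr (block_mx _ _ _ _).
  rewrite /cg tr_mat3 !mul_mat3 /p' /w vE2; congr mat3; field; by rewrite ?a0 ?u0.
have [Y [dY EN]] := cancel_line v0 ds' dz (esym (zE _ _ _ _)) Ez Es'.
have ca0 : c / a != 0 by rewrite mulf_neq0 ?invr_eq0.
have L1 : leqs us (1 :: - c ^+ 2 :: us3).
  by apply: (IH M) => //; apply: dec_plane dt c0 E3 d3.
have L2 : leqs (1 :: - (c / a) ^+ 2 :: us3) vs.
  by apply: (IH N) => //; rewrite EN; apply: dec_cg => //; apply: dec_block_plane.
apply: leqs_trans (leqs_cons u0 L1) _; apply: leqs_trans (leqs_cons v0 L2).
have y0 : - (c / a) ^+ 2 != 0 by rewrite oppr_eq0 expf_neq0.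
have x0 : - c ^+ 2 != 0 by rewrite oppr_eq0 expf_neq0.
have o0 : (1 : k) != 0 := oner_neq0 k.
apply: leqs_sym.
(* As v = a^2 u, the square a^2 can be moved from v to - (c / a)^2, which becomes - c^2. *)
apply: leqs_trans (leqs_cons v0 (leqs_swap _ o0 y0)) _.
rewrite vE2 mulrC; apply: leqs_trans (leqs_square _ u0 y0 a0) _.
have -> : - (c / a) ^+ 2 * a ^+ 2 = - c ^+ 2 by field.
exact: leqs_cons u0 (leqs_swap _ x0 o0).
Qed.

(** Trades a plane in front for a line, as soon as the form has a nonzero value. The vector y e + f
    of the plane has value p + 2 c y; if this is nonzero for y = 0 or y = 1, the plane is
    diagonalised there. Otherwise p = 0 and 2 c = 0, the plane is alternating, and the nonzero value
    gives a line in the complement, which is moved to the front. *)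
Lemma plane_to_line (k : fieldType) n c p (N : 'M[k]_n) us (M : 'M[k]_n.+2) (g : 'M_n.+2) x :
  dec_uniq_at k n -> symnd_pt M -> \det g = 1 -> c != 0 ->
  cg g M = block_mx (mat2 0 c c p) 0 0 N :> 'M_(2 + n) -> dec N us ->
  qf M x != 0 ->
  exists h u N' ws, [/\ \det h = 1, u != 0,
    cg h M = block_mx (u%:M : 'M_1) 0 0 N', dec N' ws
    & leqs (1 :: - c ^+ 2 :: us) (u :: ws)].
Proof.
move=> IH sM dg c0 Eg dN qx.
have sN : symnd_pt N.
  by apply: (@symnd_block _ 2 n (mat2 0 c c p)); rewrite -Eg; apply: symnd_cg.
have y0 : - c ^+ 2 != 0 by rewrite oppr_eq0 expf_neq0.
have o0 : (1 : k) != 0 := oner_neq0 k.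
have diag y : p + c * y *+ 2 != 0 -> exists h u N' ws, [/\ \det h = 1, u != 0,
    cg h M = block_mx (u%:M : 'M_1) 0 0 N', dec N' ws
    & leqs (1 :: - c ^+ 2 :: us) (u :: ws)].
  set p' := p + _ => p0.
  (* The first column is y e + f, of value p'; the second is (c / p') (y e + f) - e, which is
     orthogonal to it and makes the determinant 1. *)
  pose Z := mat2 y (y * c / p' - 1) 1 (c / p').
  have dZ : \det Z = 1 by rewrite det_mat2; field.
  have EZ : cg Z (mat2 0 c c p) = mat2 p' 0 0 (- c ^+ 2 / p').
    rewrite /cg tr_mat2 !mul_mat2 (_ : p = p' - c * y *+ 2); last by rewrite addrK.
    by congr mat2; field.
  pose f := block_mx Z 0 0 1%:M : 'M_(2 + n).
  have df : \det f = 1 by rewrite /f det_block_diag dZ det1 mulr1.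
  have v0 : - c ^+ 2 / p' != 0 by rewrite mulf_neq0 ?invr_eq0.
  exists (g *m f), p', (block_mx ((- c ^+ 2 / p')%:M : 'M_1) 0 0 N), (- c ^+ 2 / p' :: us).
  split=> //; first by rewrite det_mulmx dg df mulr1.
  - transitivity (cg f (block_mx (mat2 0 c c p) 0 0 N : 'M_(2 + n))).
      by rewrite cg_mul Eg.
    by rewrite /f cg_diag cg1 EZ block_112.
  - exact: dec_block_line.
  - by apply/leqs_sym/leqs_plane.
have [p0|] := eqVneq p 0; last by move=> p0; apply: (diag 0); rewrite mulr0 mul0rn addr0.
have [c2|] := eqVneq (c *+ 2) 0; last by move=> c2; apply: (diag 1); rewrite p0 add0r mulr1.
have ug : g \in unitmx by exact: det1_unit.
pose z : 'cV_(2 + n) := invmx g *m x.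
have qz : qf N (dsubmx z) != 0.
  have := qf_block (mat2 0 c c p) N (usubmx z) (dsubmx z).
  rewrite vsubmxK -[block_mx _ _ _ _]Eg qf_cg mulKVmx // qf_mat2 p0 -mulr2n c2.
  by rewrite !mul0r !add0r => <-.
case: n N us M g x IH sM dg Eg dN qx sN ug z qz diag =>
    [|n] N us M g x IH sM dg Eg dN qx sN ug z qz diag.
  by move: qz; rewrite /qf [dsubmx z]flatmx0 mulmx0 mxE eqxx.
have [t [l [dt Et St]]] := split_adapted (dsubmx z) sN.
have q0 : (cg t N) 0 0 != 0.
  by apply: contraNneq qz => q0; rewrite Et qfZ -qf_cg qf_e1 q0 mulr0.
have [b [N' [b0 EN]]] := split_form_line q0 St.
have [ws dws] : exists ws, dec N' ws.
  by apply: dec_exists; apply: (@symnd_block _ 1 n b%:M); rewrite -EN; apply: symnd_cg.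
have L : leqs us (b :: ws) by apply: (IH N) => //; apply: dec_line dt b0 EN dws.
pose f := block_mx (1%:M : 'M_2) 0 0 t : 'M_(2 + n.+1).
have df : \det f = 1 by rewrite /f det_block_diag det1 mul1r.
have Ef : cg (g *m f) M = block_mx (mat2 0 c c p) 0 0 (block_mx (b%:M : 'M_1) 0 0 N').
  transitivity (cg f (block_mx (mat2 0 c c p) 0 0 N : 'M_(2 + n.+1))).
    by rewrite cg_mul Eg.
  by rewrite /f cg_diag cg1 EN.
(* A cyclic permutation of three vectors is even, so the line passes the plane without a sign. *)
pose P : 'M[k]_3 := mat3 0 1 0 0 0 1 1 0 0.
pose f' := block_mx P 0 0 1%:M : 'M_(3 + n).
have df' : \det f' = 1 by rewrite /f' det_block_diag det1 mulr1 det_mat3; ring.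
have EP : cg P (mat3 0 c 0 c p 0 0 0 b) = mat3 b 0 0 0 0 c 0 c p.
  by rewrite /cg tr_mat3 !mul_mat3; congr mat3; ring.
exists (g *m f *m f'), b, (block_mx (mat2 0 c c p) 0 0 N'), (1 :: - c ^+ 2 :: ws).
split=> //; first by rewrite !det_mulmx dg df df' !mulr1.
- rewrite block_123 mat3_dr -EP -mat3_ul.
  transitivity (cg f' (block_mx (block_mx (mat2 0 c c p) 0 0 b%:M : 'M_(2 + 1)) 0 0 N'
    : 'M_(3 + n))); last by rewrite /f' cg_diag cg1.
  by rewrite cg_mul Ef block_213.
- exact: dec_block_plane.
- apply: leqs_trans (leqs_cons o0 (leqs_cons y0 L)) _.
  apply: leqs_trans (leqs_cons o0 (leqs_swap _ y0 b0)) _.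
  exact: leqs_swap.
Qed.

(** No line can split off, and each plane has p = 0 and 2 c = 0, so that - c^2 = c^2 is a square.
    The squares can be gathered in a single term, which must then be the determinant. *)
Lemma alternating_dec (k : fieldType) n (M : 'M[k]_n) us :
  symnd_pt M -> (forall x, qf M x = 0) -> dec M us -> (0 < n)%N ->
  exists2 m, n = m.+2 & leqs us (1 :: \det M :: nseq m 1).
Proof.
elim/ltn_ind: n M us => -[//|n] IH M us sM qM [] => [[g [u [N [us' [dg u0 E _ _]]]]] _|].
  have := qM (g *m delta_mx 0 0); rewrite -qf_cg qf_e1 E line_corner => /eqP.
  by rewrite (negPf u0).
case: n IH M sM qM => [//|n] IH M sM qM [g [c [p [N [us' [dg c0 E dN ->]]]]]] _.
exists n => //.
have qE x y : qf (mat2 0 c c p) x + qf N y = 0.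
  rewrite -qf_block -[block_mx _ _ _ _]E qf_cg; exact: qM.
have qN y : qf N y = 0.
  by have := qE 0 y; rewrite {1}/qf mulmx0 mxE add0r.
have qP x : qf (mat2 0 c c p) x = 0 by have := qE x 0; rewrite qN addr0.
have p0 : p = 0.
  have := qP (delta_mx 1 0); rewrite qf_mat2 !mxE /= => e; rewrite -[RHS]e; ring.
have c2 : c + c = 0.
  have := qP (const_mx 1); rewrite qf_mat2 !mxE p0 => e; rewrite -[RHS]e; ring.
have o0 : (1 : k) != 0 := oner_neq0 k.
have dM : \det M = - c ^+ 2 * \det N.
  rewrite -(det_cg1 M dg) E; have := det_block_diag (mat2 0 c c p) N; rewrite det_mat2 => ->.
  by ring.
have cc : - c ^+ 2 = 1 * c ^+ 2.
  by apply/eqP; rewrite eqr_oppLR -subr_eq0 opprK mul1r expr2 -mulrDr c2 mulr0.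
have sN : symnd_pt N.
  by apply: (@symnd_block _ 2 n (mat2 0 c c p)); rewrite -E; apply: symnd_cg.
case: n IH N M us' g sM sN qM dg E dN qE qN dM =>
    [|n] IH N M us' g sM sN qM dg E dN qE qN dM.
  by rewrite dM det_mx00 mulr1 dN; exact: leqs_refl.
have lt : (n.+1 < n.+3)%N by lia.
have [m En L] := IH _ lt N us' sN qN dN isT.
have dN0 : \det N != 0 by rewrite -unitfE; case: sN.
have -> : nseq n.+1 1 = 1 :: 1 :: nseq m 1 :> seq k by case: En => ->.
have y0 : - c ^+ 2 != 0 by rewrite oppr_eq0 expf_neq0.
apply: leqs_trans (leqs_cons o0 (leqs_cons y0 L)) _; apply: (leqs_cons o0).
apply: leqs_trans (leqs_cons y0 (leqs_swap _ o0 dN0)) _; rewrite cc.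
apply: leqs_trans (leqs_square _ o0 dN0 c0) _.
rewrite dM cc mul1r [_ * \det N]mulrC.
by apply: leqs_swap; rewrite ?mulf_neq0 ?expf_neq0.
Qed.

(** Unless the form is alternating, both splittings can be made to begin with a line, and two such
    splittings are compared through their first vectors. *)
Lemma dec_unique (k : fieldType) n : dec_uniq_at k n.
Proof.
elim/ltn_ind: n => -[|n] IH M us vs sM; first by move=> /= -> ->; exact: leqs_refl.
have LL g u N us' h v N' vs' : \det g = 1 -> u != 0 ->
    cg g M = block_mx u%:M 0 0 N :> 'M_(1 + n) -> dec N us' ->
    \det h = 1 -> v != 0 -> cg h M = block_mx v%:M 0 0 N' :> 'M_(1 + n) -> dec N' vs' ->
    leqs (u :: us') (v :: vs').
  move=> dg u0 Eg dN dh v0 Eh dN'.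
  apply: (@leqs_line_line _ _ u v N N' (invmx g *m h)) => //.
  - exact: IH.
  - by apply: (@symnd_block _ 1 n u%:M); rewrite -Eg; apply: symnd_cg.
  - by apply: (@symnd_block _ 1 n v%:M); rewrite -Eh; apply: symnd_cg.
  - by rewrite det_mulmx det1_inv // dh mulr1.
  - by rewrite -Eg -Eh -cg_mul mulKVmx // det1_unit.
have [[x qx]|alt] := Classical_Prop.classic (exists x, qf M x != 0); last first.
  have {}alt x : qf M x = 0.
    by apply/eqP/negPn/negP=> qx; apply: alt; exists x.
  move=> dM dM'; have [m En L] := alternating_dec sM alt dM isT.
  have [m' En' L'] := alternating_dec sM alt dM' isT.
  have mm : m = m' by lia.
  by apply: leqs_trans L _; rewrite mm; exact: leqs_sym.
have toL ws : dec M ws -> exists g u N ws', [/\ \det g = 1, u != 0,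
    cg g M = block_mx u%:M 0 0 N :> 'M_(1 + n), dec N ws' & leqs ws (u :: ws')].
  case=> [[g [u [N [us' [dg u0 E dN ->]]]]]|].
    by exists g, u, N, us'; split=> //; exact: leqs_refl.
  case: n IH M sM {LL} x qx => [//|n] IH M sM x qx [g [c [p [N [us' [dg c0 E dN ->]]]]]].
  exact: plane_to_line (IH n (leqW (leqnn _))) sM dg c0 E dN qx.
move=> /toL [g [u [N [us' [dg u0 Eg dN L]]]]] /toL [h [v [N' [vs' [dh v0 Eh dN' L']]]]].
apply: leqs_trans L _; apply: leqs_trans _ (leqs_sym L').
exact: LL dg u0 Eg dN dh v0 Eh dN'.
Qed.

(** * Naive homotopies *)

Notation evP t := (map_poly (evT t)).

Lemma evPE (k : fieldType) (t : k) : evP t = map_poly (horner_eval t).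
Proof. by []. Qed.

Lemma evP_polyC (k : fieldType) (t : k) (A : {poly k}) : evP t A^:P = A.
Proof.
by rewrite evPE; apply/polyP=> i; rewrite !coef_map /=; exact: hornerC.
Qed.

Lemma ratfun_map (R S : comUnitRingType) (f : {rmorphism R -> S}) n (A B : {poly R}) :
  ratfun_pt n A B -> ratfun_pt n (map_poly f A) (map_poly f B).
Proof.
move=> r; have [mA sA sB _] := r; have [U [V [e _ _]]] := ratfun_bezout r.
apply: (@bezout_ratfun _ _ _ _ (map_poly f U) (map_poly f V)).
- exact: monic_map.
- by rewrite size_map_poly_id0 // (eqP mA) rmorph1 oner_eq0.
- by rewrite (leq_trans (size_poly _ _)).
- by rewrite -!rmorphM -rmorphD e rmorph1.
Qed.

Lemma bezout_rel_map (R S : comNzRingType) (f : {rmorphism R -> S}) n (A B U V : {poly R}) :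
  bezout_rel n A B U V ->
  bezout_rel n (map_poly f A) (map_poly f B) (map_poly f U) (map_poly f V).
Proof.
move=> [e sU sV]; split; first by rewrite -!rmorphM -rmorphD e rmorph1.
- by rewrite (leq_trans (size_poly _ _)).
- by rewrite (leq_trans (size_poly _ _)).
Qed.

Lemma rst_congr (S T : Type) (rS : relation S) (rT : relation T) (f : S -> T) :
  (forall x y, rS x y -> rT (f x) (f y)) -> forall x y,
  clos_refl_sym_trans S rS x y -> clos_refl_sym_trans T rT (f x) (f y).
Proof.
move=> h x y; elim=> {x y} [x y /h|x|x y _|x y z _ I1 _ I2].
- exact: rst_step.
- exact: rst_refl.
- exact: rst_sym.
- exact: rst_trans I1 I2.
Qed.

(** Only the first summand moves. Its Bezout coefficients over k[T] are supplied explicitly, so the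
    choice hidden in [oplusN] does not intervene. *)
Lemma htp_oplus (k : fieldType) n1 n2 (A1 B1 U V : {poly {poly k}}) (A2 B2 : {poly k}) :
  A1 \is monic -> size A1 = n1.+1 -> (size B1 <= n1)%N ->
  A1 * U + B1 * V = 1 -> (size U <= n1.+1)%N -> (size V <= n1)%N ->
  ratfun_pt n2 A2 B2 ->
  let F t := (evP t A1 * A2 - evP t V * B2, evP t B1 * A2 + evP t U * B2) in
  htpF (n1 + n2) (F 0) (F 1).
Proof.
move=> mA sA sB e sU sV /(ratfun_map polyC) r2 F.
exists (A1 * A2^:P - V * B2^:P, B1 * A2^:P + U * B2^:P).
have E t : (evP t (A1 * A2^:P - V * B2^:P), evP t (B1 * A2^:P + U * B2^:P)) = F t.
  rewrite /F -[in RHS](evP_polyC t A2) -[in RHS](evP_polyC t B2) !evPE.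
  by rewrite !(rmorphB, rmorphD, rmorphM).
by split; [exact: ratfun_oplus | exact: E | exact: E].
Qed.

Lemma htpF_stepF (k : fieldType) n (u : k) x y :
  u != 0 -> htpF n x y -> htpF n.+1 (stepF u x) (stepF u y).
Proof.
move=> u0 [H [r <- <-]]; have uu : u%:P \is a GRing.unit.
  by rewrite rmorph_unit ?unitfE.
have E t : (evP t (stepF u%:P H).1, evP t (stepF u%:P H).2) =
    stepF u (evP t H.1, evP t H.2).
  have eu : horner_eval t u%:P = u by exact: hornerC.
  rewrite /stepF /= !evPE rmorphB rmorphM /= map_polyX !map_polyZ /= eu.
  suff -> : horner_eval t u%:P^-1 = u^-1 by [].
  apply: (mulfI u0); have := congr1 (horner_eval t) (mulrV uu).
  by rewrite rmorphM /= eu mulfV // => ->; rewrite rmorph1.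
exists (stepF u%:P H); split; [exact: ratfun_stepF | exact: E | exact: E].
Qed.

Lemma naiveF_stepF (k : fieldType) n (u : k) x y :
  u != 0 -> naiveF n x y -> naiveF n.+1 (stepF u x) (stepF u y).
Proof. by move=> u0; apply: rst_congr => x' y'; exact: htpF_stepF. Qed.

Lemma htpS_cg (k : fieldType) n (g M : 'M[k]_n) :
  symnd_pt M -> \det g = 1 -> htpS n M (cg g M).
Proof.
move=> sM /SL_path [G [dG G0 G1]]; exists (cg G (map_mx polyC M)).
have E t : map_mx (evT t) (cg G (map_mx polyC M)) = cg (map_mx (evT t) G) M.
  rewrite !evTE map_cg; congr cg; apply/matrixP=> i j; rewrite !mxE; exact: hornerC.
split; first by apply: symnd_cg => //; apply: (symnd_map polyC).
  by rewrite E G0 cg1.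
by rewrite E G1.
Qed.

Lemma symnd_diag (R : comUnitRingType) m n (M : 'M[R]_m) (N : 'M_n) :
  symnd_pt M -> symnd_pt N -> symnd_pt (block_mx M 0 0 N).
Proof.
move=> [sM uM] [sN uN]; split; first by rewrite tr_block_mx !trmx0 sM sN.
by rewrite det_block_diag unitrM uM.
Qed.

Lemma map_polyCK (k : fieldType) m n (t : k) (M : 'M[k]_(m, n)) :
  map_mx (evT t) (map_mx polyC M) = M.
Proof. by apply/matrixP=> i j; rewrite !mxE; exact: hornerC. Qed.

Lemma naiveS_diagl (k : fieldType) m n (N : 'M[k]_m) (M M' : 'M_n) :
  symnd_pt N -> naiveS n M M' -> naiveS (m + n) (block_mx N 0 0 M) (block_mx N 0 0 M').
Proof.
move=> sN; apply: rst_congr => x y [H [sH H0 H1]].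
exists (block_mx (map_mx polyC N) 0 0 H).
have E t : map_mx (evT t) (block_mx (map_mx polyC N) 0 0 H) =
    block_mx N 0 0 (map_mx (evT t) H).
  by rewrite map_block_mx map_polyCK evTE !map_mx0.
by rewrite !E H0 H1; split=> //; apply: symnd_diag => //; apply: (symnd_map polyC).
Qed.

Lemma naiveS_diagr (k : fieldType) m n (N : 'M[k]_n) (M M' : 'M_m) :
  symnd_pt N -> naiveS m M M' -> naiveS (m + n) (block_mx M 0 0 N) (block_mx M' 0 0 N).
Proof.
move=> sN; apply: (@rst_congr _ _ _ _ (fun X => block_mx X 0 0 N)) => x y [H [sH H0 H1]].
exists (block_mx H 0 0 (map_mx polyC N)).
have E t : map_mx (evT t) (block_mx H 0 0 (map_mx polyC N)) =
    block_mx (map_mx (evT t) H) 0 0 N.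
  by rewrite map_block_mx map_polyCK evTE !map_mx0.
by rewrite !E H0 H1; split=> //; apply: symnd_diag => //; apply: (symnd_map polyC).
Qed.

(** * Lifting paths of forms of rank 2 to rational functions *)

(* An explicit section of the Bezout map in rank 2, followed by the sum with [f]:
   [[p, d], [d, c]] of determinant D is the Bezout form of
   (X^2 - (p d / D) X - p^2 / D) / (c X + d), whose Bezout coefficients are
   U = - c^2 / D and V = (c / D) X - d (2 D + d^2) / D^2. *)
Definition rank2F (R : comUnitRingType) (M : 'M[R]_2) : {poly R} * {poly R} :=
  ('X^2 - (M 0 0 * M 0 1 / \det M)%:P * 'X - (M 0 0 ^+ 2 / \det M)%:P,
   (M 1 1)%:P * 'X + (M 0 1)%:P).

Definition rank2UV (R : comUnitRingType) (M : 'M[R]_2) : {poly R} * {poly R} :=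
  ((- M 1 1 ^+ 2 / \det M)%:P,
   (M 1 1 / \det M)%:P * 'X - (M 0 1 * (\det M *+ 2 + M 0 1 ^+ 2) * (\det M)^-1 ^+ 2)%:P).

Definition rank2_oplus (R : comUnitRingType) (M : 'M[R]_2) (f : {poly R} * {poly R}) :=
  ((rank2F M).1 * f.1 - (rank2UV M).2 * f.2, (rank2F M).2 * f.1 + (rank2UV M).1 * f.2).

Lemma size_lin_le (R : nzRingType) (a b : R) : (size (a%:P * 'X + b%:P)%R <= 2)%N.
Proof.
apply: size_add_le; last by rewrite (leq_trans (size_polyC_leq1 _)).
exact: (size_mul_le (size_polyC_leq1 a) (eq_leq (size_polyX R))).
Qed.

Lemma rank2_bezout (R : comUnitRingType) (M : 'M[R]_2) : symnd_pt M ->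
  (rank2F M).1 * (rank2UV M).1 + (rank2F M).2 * (rank2UV M).2 = 1.
Proof.
case=> sM uM; rewrite /rank2F /rank2UV /=.
have dM : \det M = M 0 0 * M 1 1 - M 0 1 ^+ 2.
  rewrite [M in LHS]mat2P det_mat2 expr2; congr (_ - _ * _).
  by rewrite -[in LHS]sM mxE.
have [w wE dw] : exists2 w, w = (\det M)^-1 & \det M * w = 1.
  by exists (\det M)^-1 => //; rewrite mulrV.
rewrite -!wE; move: dM dw; set D := \det M; set p := M 0 0.
set d := M 0 1; set c := M 1 1 => dM dw.
(* With w = 1 / D treated as a variable, the relation is a polynomial identity up to the
   substitution D w = 1. *)
transitivity ((D * w)%:P ^+ 2 + (d * c * w)%:P * (1 - (D * w)%:P) * 'X).
  by rewrite dM !(polyCM, polyCN, polyCB, polyCD, polyCMn, polyC_exp); ring.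
by rewrite dw subrr mulr0 mul0r addr0 expr1n.
Qed.

Lemma rank2F_map (R S : comUnitRingType) (f : {rmorphism R -> S}) (M : 'M[R]_2) :
  \det M \is a GRing.unit ->
  map_poly f (rank2F M).1 = (rank2F (map_mx f M)).1 /\
  map_poly f (rank2F M).2 = (rank2F (map_mx f M)).2.
Proof.
move=> uM; rewrite /rank2F /= det_map_mx !mxE.
rewrite !(rmorphB, rmorphD, rmorphXn, rmorphM) /= !map_polyC !map_polyX /=.
by rewrite (rmorphV f uM).
Qed.

Lemma rank2UV_map (R S : comUnitRingType) (f : {rmorphism R -> S}) (M : 'M[R]_2) :
  \det M \is a GRing.unit ->
  map_poly f (rank2UV M).1 = (rank2UV (map_mx f M)).1 /\
  map_poly f (rank2UV M).2 = (rank2UV (map_mx f M)).2.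
Proof.
move=> uM; rewrite /rank2UV /= det_map_mx !mxE.
rewrite !(rmorphB, rmorphD, rmorphM) /= !map_polyC map_polyX /=.
by rewrite !(rmorphM, rmorphN, rmorphD, rmorphMn, rmorphXn) /= (rmorphV f uM).
Qed.

Lemma rank2_oplus_htp (k : fieldType) n (M N : 'M[k]_2) (f : {poly k} * {poly k}) :
  ratfun_pt n f.1 f.2 -> htpS 2 M N -> htpF (2 + n) (rank2_oplus M f) (rank2_oplus N f).
Proof.
move=> rf [H [sH HM HN]].
have uH : \det H \is a GRing.unit by case: sH.
have E t : (evP t (rank2F H).1 * f.1 - evP t (rank2UV H).2 * f.2,
            evP t (rank2F H).2 * f.1 + evP t (rank2UV H).1 * f.2) =
    rank2_oplus (map_mx (evT t) H) f.
  rewrite evPE evTE /rank2_oplus.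
  have [-> ->] := rank2F_map (horner_eval t) uH.
  by have [-> ->] := rank2UV_map (horner_eval t) uH.
have E2 : (rank2F H).1 = 'X^2 - ((H 0 0 * H 0 1 / \det H)%:P * 'X + (H 0 0 ^+ 2 / \det H)%:P).
  by rewrite opprD addrA.
have s2 := size_lin_le (H 0 0 * H 0 1 / \det H) (H 0 0 ^+ 2 / \det H).
rewrite -HM -HN -!E; apply: htp_oplus => //.
- by rewrite E2 monicE lead_coefDl ?lead_coefXn ?size_polyXn ?size_polyN.
- by rewrite E2 size_polyDl ?size_polyXn ?size_polyN.
- exact: size_lin_le.
- exact: rank2_bezout.
- by rewrite (leq_trans (size_polyC_leq1 _)).
- by rewrite /= -polyCN; exact: size_lin_le.
Qed.

(** The entries come in reverse order: in the basis 1, X of the Bezout matrix, the outer summand X /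
    u contributes at X. *)
Lemma rank2_oplus_diag (k : fieldType) (u v : k) f : u != 0 -> v != 0 ->
  rank2_oplus (mat2 v 0 0 u) f = stepF u (stepF v f).
Proof.
move=> u0 v0; rewrite /rank2_oplus /rank2F /rank2UV /stepF /= det_mat2 !mxE /=.
have E1 : v ^+ 2 / (v * u - 0 * 0) = u^-1 * v by field; rewrite ?u0 ?v0.
have E2 : - u ^+ 2 / (v * u - 0 * 0) = - (u * v^-1) by field; rewrite ?u0 ?v0.
have E3 : u / (v * u - 0 * 0) = v^-1 by field; rewrite ?u0 ?v0.
have E4 : u * u^-1 = 1 by rewrite mulfV.
rewrite E1 E2 E3 !(mulr0, mul0r) !polyC0 !(subr0, addr0, mul0r).
rewrite -!mul_polyC !(polyCN, polyCM).
by congr pair; ring.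
Qed.

Lemma rank2_oplus_naive (k : fieldType) n (M N : 'M[k]_2) (f : {poly k} * {poly k}) :
  ratfun_pt n f.1 f.2 -> naiveS 2 M N ->
  naiveF (2 + n) (rank2_oplus M f) (rank2_oplus N f).
Proof.
move=> rf; apply: (@rst_congr _ _ _ _ (fun X => rank2_oplus X f)) => x y.
exact: rank2_oplus_htp.
Qed.

Lemma symnd_mat2 (k : fieldType) (a b c : k) : a * c - b * b != 0 -> symnd_pt (mat2 a b b c).
Proof. by move=> h; split; [exact: tr_mat2 | rewrite det_mat2 unitfE]. Qed.

Lemma naiveS_plane (k : fieldType) (c p q : k) : c != 0 ->
  naiveS 2 (mat2 0 c c p) (mat2 0 c c q).
Proof.
move=> c0; apply: rst_step; exists (mat2 0 c%:P c%:P (p%:P + (q - p)%:P * 'X)).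
have E t : map_mx (evT t) (mat2 0 c%:P c%:P (p%:P + (q - p)%:P * 'X)) =
    mat2 0 c c (p + (q - p) * t).
  by rewrite map_mat2 /evT !hornerE.
rewrite !E mulr0 mulr1 addr0 (addrC p) subrK; split=> //; split; first exact: tr_mat2.
by rewrite det_mat2 mul0r sub0r -polyCM -polyCN poly_unitE size_polyC coefC /= unitfE oppr_eq0 mulf_neq0.
Qed.

Lemma naiveS_plane_diag (k : fieldType) (c p : k) : c != 0 -> p != 0 ->
  naiveS 2 (mat2 0 c c p) (mat2 (- c ^+ 2 / p) 0 0 p).
Proof.
move=> c0 p0; pose g := mat2 1 0 (- c / p) 1.
have -> : mat2 (- c ^+ 2 / p) 0 0 p = cg g (mat2 0 c c p).
  by rewrite /cg tr_mat2 !mul_mat2; congr mat2; field.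
apply/rst_step/htpS_cg; last by rewrite det_mat2; ring.
by apply: symnd_mat2; rewrite mul0r sub0r oppr_eq0 mulf_neq0.
Qed.

(** The two-term relations are paths of forms of rank 2: a change of basis of determinant 1 for
    [leqs_pair], a deformation of p for [leqs_plane]. They are lifted by [rank2_oplus], with the
    tail of the sequence as fixed summand. Sizes and nonvanishing are carried along for the sake of
    symmetry and transitivity. *)
Lemma leqs_sound (k : fieldType) (us vs : seq k) : leqs us vs ->
  [/\ size us = size vs, all (fun u => u != 0) us = all (fun u => u != 0) vs
    & all (fun u => u != 0) us -> naiveF (size us) (sumF us) (sumF vs)].
Proof.
elim=> {us vs} [us|us vs _ [s a h]|vs us ws _ [s1 a1 h1] _ [s2 a2 h2]|
    u us vs u0 _ [s a h]|a l u v us u0 v0 b0 b|p c us p0 c0].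
- by split=> // _; exact: rst_refl.
- by split=> // av; apply: rst_sym; rewrite -s; apply: h; rewrite a.
- rewrite s1 s2 a1 a2; split=> // aw; apply: (@rst_trans _ _ _ (sumF vs)).
    by rewrite -s2 -s1; apply: h1; rewrite a1 a2.
  by rewrite -s2; apply: h2; rewrite a2.
- by rewrite /= s a u0; split=> //= av; rewrite -s; apply: naiveF_stepF => //; apply: h; rewrite a.
- have w0 : u * v / b != 0 by rewrite !mulf_neq0 ?invr_eq0.
  rewrite /= u0 v0 b0 w0; split=> //= az; have rz := ratfun_sumF az.
  rewrite -!rank2_oplus_diag //; apply: (rank2_oplus_naive rz).
  (* The second column is the vector of value b, in reversed coordinates; the first is orthogonal to
     it, scaled to give determinant 1. *)
  pose g := mat2 (a * u / b) l (- (l * v) / b) a.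
  have -> : mat2 (u * v / b) 0 0 b = cg g (mat2 v 0 0 u).
    rewrite /cg tr_mat2 !mul_mat2; congr mat2.
    + by transitivity (u * v * (a ^+ 2 * u + l ^+ 2 * v) / b ^+ 2); [rewrite -/b|]; field.
    + by field.
    + by field.
    + by rewrite /b; ring.
  apply/rst_step/htpS_cg; first by apply: symnd_mat2; rewrite mulr0 subr0 mulf_neq0.
  rewrite det_mat2; transitivity ((a ^+ 2 * u + l ^+ 2 * v) / b); first by field.
  by rewrite divff.
- have c20 : - c ^+ 2 != 0 by rewrite oppr_eq0 expf_neq0.
  have w0 : - c ^+ 2 / p != 0 by rewrite mulf_neq0 ?invr_eq0.
  rewrite /= p0 c20 w0 oner_neq0; split=> //= az; have rz := ratfun_sumF az.
  rewrite -!rank2_oplus_diag ?oner_neq0 //; apply: (rank2_oplus_naive rz).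
  apply: (@rst_trans _ _ _ (mat2 0 c c p)).
    by apply: rst_sym; apply: naiveS_plane_diag.
  apply: (@rst_trans _ _ _ (mat2 0 c c 1)); first exact: naiveS_plane.
  by have := naiveS_plane_diag c0 (oner_neq0 k); rewrite divr1.
Qed.

(** * The Euclidean algorithm up to homotopy *)

(* B has degree n - 1: then A / B = (X + a) / b (+) A2 / B2 by one step of the
   Euclidean algorithm, and [a] can be deformed to [0]. *)
Lemma ratfun_lin_reduce (k : fieldType) n (A B : {poly k}) :
  ratfun_pt n.+1 A B -> size B = n.+1 ->
  exists b f, [/\ b != 0, ratfun_pt n f.1 f.2 & naiveF n.+1 (A, B) (stepF b f)].
Proof.
move=> r sB; have [mA sA _ _] := r; have [U [V [e _ _]]] := ratfun_bezout r.
pose b := lead_coef B; pose A2 := b^-1 *: B.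
have b0 : b != 0 by rewrite lead_coef_eq0 -size_poly_gt0 sB.
have mA2 : A2 \is monic by rewrite monicE lead_coefZ mulVf.
have sA2 : size A2 = n.+1 by rewrite size_scale ?invr_eq0.
have EB : B = b *: A2 by rewrite scalerA mulfV // scale1r.
pose Q := A %/ A2; pose B2 := - b *: (A %% A2).
have EA : A = Q * A2 - b^-1 *: B2.
  by rewrite scalerA mulrN mulVf // scaleN1r opprK -divp_eq.
have sB2 : (size B2 <= n)%N.
  by rewrite (leq_trans (size_scale_leq _ _)) // -ltnS -sA2 ltn_modp monic_neq0.
have sQ : size Q = 2 by rewrite size_divp ?monic_neq0 // sA sA2 /= subSn ?leqnSn // subSnn.
have mQ : Q \is monic.
  move: mA; rewrite monicE EA lead_coefDl; last first.
    rewrite size_polyN size_Mmonic ?sA2 ?sQ -?size_poly_gt0 ?sQ //.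
    by rewrite (leq_ltn_trans (size_scale_leq _ _)) // ltnS leqW.
  by rewrite lead_coef_Mmonic // -monicE.
have EQ : Q = 'X + (Q`_0)%:P.
  apply/polyP=> -[|[|i]]; rewrite coefD coefX coefC /= ?add0r ?addr0 //.
    by move: mQ; rewrite monicE /lead_coef sQ => /eqP.
  by rewrite nth_default // sQ.
have r2 : ratfun_pt n A2 B2.
  apply: (@bezout_ratfun _ _ _ _ (Q * U + b *: V) (- (b^-1 *: U))) => //.
  by rewrite -e EA [in RHS]EB -!mul_polyC; ring.
exists b, (A2, B2); split=> //; apply: rst_sym; apply: rst_step.
(* The inner variable is the homotopy parameter T: the moving summand is (X + T a) / b, with Bezout
   coefficients 0 and 1 / b. *)
have E t : (evP t ('X + ('X * (Q`_0)%:P)%:P) * A2 - evP t (b^-1)%:P%:P * B2,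
            evP t b%:P%:P * A2 + evP t 0 * B2) =
    (('X + (t * Q`_0)%:P) * A2 - b^-1 *: B2, b *: A2).
  rewrite evPE rmorphD /= map_polyX !map_polyC /= rmorph0 mul0r addr0 !mul_polyC.
  by rewrite /horner_eval !hornerE.
have eb : ('X + ('X * (Q`_0)%:P)%:P) * 0 + b%:P%:P * (b^-1)%:P%:P = 1 :> {poly {poly k}}.
  by rewrite mulr0 add0r -!polyCM mulfV.
have s0 : (size (0 : {poly {poly k}})%R <= 2)%N by rewrite size_poly0.
have : htpF (1 + n) _ _ := htp_oplus (monicXaddC _) (size_XaddC _) (size_polyC_leq1 _)
  eb s0 (size_polyC_leq1 _) r2.
by rewrite !E mul0r addr0 mul1r -EQ /stepF /= -EA -EB.
Qed.

(* B has degree m < n - 1: A / B = Q / b (+) A2 / B2 with deg Q = d > 1; deform Q to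
   X^d, then X^d / b to X^d / (b + X^(d-1)) through X^d / (b + T X^(d-1)), whose
   Bezout coefficients are U = T^2 X^(d-2) / b^2 and V = (b - T X^(d-1)) / b^2. *)
Lemma ratfun_raise (k : fieldType) n (A B : {poly k}) :
  ratfun_pt n.+1 A B -> (size B <= n)%N ->
  exists f, [/\ ratfun_pt n.+1 f.1 f.2, size f.2 = n.+1 & naiveF n.+1 (A, B) f].
Proof.
move=> r sB; have [mA sA _ _] := r; have [U [V [e _ _]]] := ratfun_bezout r.
have B0 : B != 0.
  apply/eqP=> B0; have U0 : U != 0.
    by apply/eqP=> U0; move: e; rewrite U0 B0 mulr0 mul0r addr0 => /eqP; rewrite eq_sym oner_eq0.
  by have := monic_size_mul mA U0; rewrite (_ : A * U = 1) ?size_poly1 ?sA // -e B0 mul0r addr0.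
have [m sBm] : exists m, size B = m.+1.
  by exists (size B).-1; rewrite prednK // size_poly_gt0.
pose b := lead_coef B; pose A2 := b^-1 *: B.
have b0 : b != 0 by rewrite lead_coef_eq0.
have mA2 : A2 \is monic by rewrite monicE lead_coefZ mulVf.
have sA2 : size A2 = m.+1 by rewrite size_scale ?invr_eq0.
have EB : B = b *: A2 by rewrite scalerA mulfV // scale1r.
pose Q := A %/ A2; pose B2 := - b *: (A %% A2).
have EA : A = Q * A2 - b^-1 *: B2.
  by rewrite scalerA mulrN mulVf // scaleN1r opprK -divp_eq.
have sB2 : (size B2 <= m)%N.
  by rewrite (leq_trans (size_scale_leq _ _)) // -ltnS -sA2 ltn_modp monic_neq0.
(* From here on [d] is deg Q - 2, which builds in deg Q > 1. *)
have [d nE] : exists d, n.+1 = (d.+2 + m)%N.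
  by exists (n - m.+1)%N; move: sB; rewrite sBm; clear; lia.
have sQ : size Q = d.+3.
  rewrite size_divp ?monic_neq0 // sA sA2 nE; clear; lia.
have mQ : Q \is monic.
  move: mA; rewrite monicE EA lead_coefDl; last first.
    rewrite size_polyN size_Mmonic ?sA2 ?sQ -?size_poly_gt0 ?sQ //.
    rewrite (leq_ltn_trans (size_scale_leq _ _)) // (leq_ltn_trans sB2) //; clear; lia.
  by rewrite lead_coef_Mmonic // -monicE.
have r2 : ratfun_pt m A2 B2.
  apply: (@bezout_ratfun _ _ _ _ (Q * U + b *: V) (- (b^-1 *: U))) => //.
  by rewrite -e EA [in RHS]EB -!mul_polyC; ring.
have bb : b%:P * (b^-1)%:P = 1 :> {poly k} by rewrite -polyCM mulfV.
have bbP : b%:P%:P * (b^-1)%:P%:P = 1 :> {poly {poly k}} by rewrite -polyCM bb.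
pose P : {poly k} := 'X^(d.+2).
have sQP : (size (Q - P)%R <= d.+2)%N.
  apply/leq_sizeP=> j; rewrite leq_eqVlt => /orP[/eqP<-|lj].
    rewrite coefB coefXn eqxx; move: mQ; rewrite monicE /lead_coef sQ => /eqP->.
    by rewrite subrr.
  by rewrite coefB coefXn gtn_eqF // nth_default ?sQ // subr0.
pose QT : {poly {poly k}} := 'X^(d.+2) + 'X%:P * (Q - P)^:P.
have sTQ : (size ('X%:P * (Q - P)^:P : {poly {poly k}})%R <= d.+2)%N.
  have sQP' : (size (Q - P)^:P <= d.+2)%N by rewrite size_map_polyC.
  by have := size_mul_le (size_polyC_leq1 ('X : {poly k})) sQP'.
have eQT : QT * 0 + b%:P%:P * (b^-1)%:P%:P = 1 by rewrite mulr0 add0r.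
have mQT : QT \is monic.
  by rewrite monicE lead_coefDl ?lead_coefXn // size_polyXn ltnS.
have sQT : size QT = d.+3 by rewrite size_polyDl size_polyXn.
have sb : (size (b%:P%:P : {poly {poly k}})%R <= d.+2)%N.
  by rewrite (leq_trans (size_polyC_leq1 _)).
have sbi : (size ((b^-1)%:P%:P : {poly {poly k}})%R <= d.+2)%N.
  by rewrite (leq_trans (size_polyC_leq1 _)).
have s0 : (size (0 : {poly {poly k}})%R <= d.+3)%N by rewrite size_poly0.
have h1 : htpF (d.+2 + m) _ _ := htp_oplus mQT sQT sb eQT s0 sbi r2.
have E1 t : (evP t QT * A2 - evP t (b^-1)%:P%:P * B2, evP t b%:P%:P * A2 + evP t 0 * B2) =
    ((P + t%:P * (Q - P)) * A2 - b^-1 *: B2, b *: A2).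
  have eQ : evP t QT = P + t%:P * (Q - P).
    rewrite /QT -[in RHS](evP_polyC t (Q - P)) evPE rmorphD rmorphXn rmorphM /=.
    rewrite map_polyX map_polyC /=.
    by rewrite /horner_eval hornerX.
  by rewrite eQ evPE !map_polyC /= rmorph0 mul0r addr0 !mul_polyC /horner_eval !hornerC.
rewrite !E1 polyC1 mul1r polyC0 mul0r addr0 (addrC P) subrK -EA -EB in h1.
pose BT : {poly {poly k}} := b%:P%:P + 'X%:P * 'X^(d.+1).
pose UT : {poly {poly k}} := 'X%:P ^+ 2 * (b^-1)%:P%:P ^+ 2 * 'X^d.
pose VT : {poly {poly k}} := (b^-1)%:P%:P ^+ 2 * (b%:P%:P - 'X%:P * 'X^(d.+1)).
have sX : (size ('X%:P * 'X^(d.+1) : {poly {poly k}})%R <= d.+2)%N.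
  have := size_mul_le (size_polyC_leq1 ('X : {poly k})) (eq_leq (size_polyXn {poly k} d.+1)).
  by [].
have eT : 'X^(d.+2) * UT + BT * VT = 1.
  transitivity ((b%:P%:P * (b^-1)%:P%:P) ^+ 2 : {poly {poly k}}); last by rewrite bbP expr1n.
  rewrite /UT /BT /VT !exprS; ring.
have sBT : (size BT <= d.+2)%N by rewrite size_add_le.
have sUT : (size UT <= d.+1)%N.
  rewrite /UT -!polyC_exp -polyCM.
  exact: (size_mul_le (size_polyC_leq1 _) (eq_leq (size_polyXn {poly k} d))).
have sVT : (size VT <= d.+2)%N.
  by rewrite /VT -!polyC_exp; apply: (size_mul_le (size_polyC_leq1 _)); rewrite size_sub_le.
have h2 : htpF (d.+2 + m) _ _ := htp_oplus (monicXn _ _) (size_polyXn _ _) sBT eT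
  (leq_trans sUT (leqW (leqnSn _))) sVT r2.
pose F t : {poly k} * {poly k} :=
  (P * A2 - (b^-1)%:P ^+ 2 * (b%:P - t%:P * 'X^(d.+1)) * B2,
   (b%:P + t%:P * 'X^(d.+1)) * A2 + t%:P ^+ 2 * (b^-1)%:P ^+ 2 * 'X^d * B2).
have E2 t : (evP t 'X^(d.+2) * A2 - evP t VT * B2, evP t BT * A2 + evP t UT * B2) = F t.
  have ec (u : k) : horner_eval t u%:P = u by exact: hornerC.
  have eX : horner_eval t 'X = t by exact: hornerX.
  rewrite evPE /VT /BT /UT !(rmorphB, rmorphD, rmorphXn, rmorphM) /=.
  by rewrite !map_polyC !map_polyX /= !ec eX.
rewrite !E2 in h2.
have F0 : F 0 = (P * A2 - b^-1 *: B2, b *: A2).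
  have bi : (b^-1)%:P ^+ 2 * b%:P * B2 = (b^-1)%:P * B2.
    by rewrite -[RHS]mul1r -bb; ring.
  by rewrite /F polyC0 expr0n /= !(mul0r, addr0, subr0) bi !mul_polyC.
(* At T = 1 the leading term of the denominator is that of X^(deg Q - 1) times [A2], of degree one
   less than the numerator; the term with [B2] has lower degree. *)
have sF : size (F 1).2 = n.+1.
  rewrite /F polyC1 !mul1r expr1n mul1r /=.
  have sbX : size (b%:P + 'X^(d.+1)) = d.+2.
    by rewrite addrC size_polyDl size_polyXn // (leq_ltn_trans (size_polyC_leq1 _)).
  have s1 : size ((b%:P + 'X^(d.+1)) * A2) = (d.+2 + m)%N.
    by rewrite size_Mmonic // -?size_poly_gt0 sbX // sA2 addnS.
  rewrite size_polyDl ?s1 -?nE //.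
  rewrite -polyC_exp; have s3 := size_mul_le (size_polyC_leq1 (b^-1 ^+ 2)) (eq_leq (size_polyXn k d)).
  by rewrite (leq_ltn_trans (size_mul_le s3 sB2)) // nE; clear; lia.
exists (F 1); split=> //.
- rewrite nE; have [H [rH _ <-]] := h2.
  exact: (ratfun_map (horner_eval 1) rH).
- rewrite nE; apply: (@rst_trans _ _ _ (F 0)); last exact: rst_step.
  by apply: rst_sym; apply: rst_step; rewrite F0 -EB.
Qed.

Lemma ratfun_sumF_rep (k : fieldType) n (A B : {poly k}) : ratfun_pt n A B ->
  exists us, [/\ all (fun u => u != 0) us, size us = n & naiveF n (A, B) (sumF us)].
Proof.
elim: n A B => [|n IH] A B r.
  have [mA sA + _] := r; rewrite leqn0 size_poly_eq0 => /eqP ->.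
  exists [::]; split=> //; have -> : A = 1; last exact: rst_refl.
  by rewrite [A]size1_polyC ?sA //; move/eqP: mA; rewrite /lead_coef sA => ->.
have [f [rf sf hf]] : exists f, [/\ ratfun_pt n.+1 f.1 f.2, size f.2 = n.+1
    & naiveF n.+1 (A, B) f].
  have [_ _ + _] := r; rewrite leq_eqVlt => /orP[/eqP sB|]; last exact: ratfun_raise r.
  by exists (A, B); split=> //; exact: rst_refl.
case: f rf sf hf => A' B' rf sf hf.
have [b [[A2 B2] [b0 r2 h2]]] := ratfun_lin_reduce rf sf.
have [us [au su hu]] := IH _ _ r2.
exists (b :: us); rewrite /= b0 su; split=> //.
apply: rst_trans hf _; apply: rst_trans h2 _.
exact: naiveF_stepF.
Qed.

(** * The Bezout form of X / u (+) A / B *)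

Lemma sum_delta_nat (R : nzRingType) n (c : nat -> R) (l : nat) :
  (forall i, (n <= i)%N -> c i = 0) -> \sum_(i < n) c i * (i == l :> nat)%:R = c l.
Proof.
move=> c0; have [ln|nl] := ltnP l n; last first.
  rewrite c0 // big1 // => i _; rewrite (_ : (i == l :> nat) = false) ?mulr0 //.
  by apply/negP=> /eqP il; move: nl; rewrite -il leqNgt ltn_ord.
rewrite (bigD1 (Ordinal ln)) //= eqxx mulr1 big1 ?addr0 // => i il.
by rewrite (_ : (i == l :> nat) = false) ?mulr0 //; apply: negPf.
Qed.

(* In the basis 1, X, ..., X^(n-1), A the Bezout form of X / u (+) A / B is
   Bez (A / B) + <u>. *)
Lemma bezmx_stepF (k : fieldType) n (u : k) (A B : {poly k}) :
  u != 0 -> ratfun_pt n A B ->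
  exists g, \det g = 1 /\ bezmx n.+1 (stepF u (A, B)).1 (stepF u (A, B)).2 =
    cg g (block_mx (u%:M : 'M_1) 0 0 (bezmx n A B)).
Proof.
move=> u0 r; have [mA sA sB _] := r.
pose a : 'rV[k]_n.+1 := \row_j A`_j.
pose E : 'M[k]_(n, n.+1) := \matrix_(i, j) (i == j :> nat)%:R.
pose G : 'M[k]_(1 + n, n.+1) := col_mx a E.
pose s : k := (-1) ^+ n.
have ss : s * s = 1 by rewrite -expr2 -exprM mulnC exprM sqrrN !expr1n.
have dG : \det (G : 'M_n.+1) = s.
  rewrite (expand_det_col _ ord_max) (bigD1 ord0) //= big1 ?addr0; last first.
    move=> i i0; have [j ->] : exists j, i = lift 0 j.
      by case: (unliftP 0 i) i0 => [j ->|->] // _; exists j.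
    rewrite (_ : G _ _ = 0) ?mul0r // /G (_ : lift 0 j = rshift 1 j); last exact: val_inj.
    by rewrite col_mxEd mxE /= ltn_eqF.
  have -> : G ord0 ord_max = 1.
    have e0 : ord0 = lshift n 0 :> 'I_(1 + n) by exact: val_inj.
    rewrite /G e0.
    by rewrite col_mxEu mxE /=; move: mA; rewrite monicE /lead_coef sA => /eqP.
  rewrite mul1r /cofactor (_ : row' _ _ = 1%:M) ?det1 ?mulr1 //.
  apply/matrixP=> i j; rewrite [LHS]mxE [LHS]mxE [RHS]mxE.
  have -> : lift ord0 i = rshift 1 i :> 'I_(1 + n) by exact: val_inj.
  have GE (l : 'I_n) m : G (rshift 1 l) m = (l == m :> nat)%:R.
    by rewrite /G col_mxEd mxE.
  by rewrite (GE i) /= /bump leqNgt ltn_ord add0n.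
(* The coordinate matrix [G] has determinant (-1)^n; rescaling the line by this sign restores
   determinant 1 and leaves <u> unchanged. *)
pose h : 'M[k]_(1 + n) := block_mx s%:M 0 0 1%:M.
have dh : \det h = s by rewrite /h det_block_diag det1 mulr1 det_scalar1.
exists (h *m G : 'M_n.+1); split; first by rewrite det_mulmx dh dG ss.
rewrite cg_mul {1}/h cg_diag cg1.
have -> : cg (s%:M : 'M_1) u%:M = u%:M.
  by rewrite /cg tr_scalar_mx -!scalar_mxM mulrAC ss mul1r.
rewrite /cg.
have -> : (G : 'M_n.+1)^T *m (block_mx (u%:M : 'M_1) 0 0 (bezmx n A B) : 'M_n.+1) *m G =
    a^T *m u%:M *m a + E^T *m bezmx n A B *m E.
  transitivity (G^T *m (block_mx (u%:M : 'M_1) 0 0 (bezmx n A B)) *m G) => //.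
  by rewrite /G tr_col_mx mul_row_block !mulmx0 addr0 add0r mul_row_col.
have sA' : (size A <= n.+1)%N by rewrite sA.
have sB' : (size B <= n.+1)%N by exact: leqW.
apply/matrixP=> i j; rewrite [LHS]mxE bezq_stepF ?unitfE // coefD coefMC coef_map /=.
rewrite coefD coefCM coefZ mul_mx_scalar -scalemxAl [RHS]mxE; congr (_ + _).
  by rewrite !mxE big_ord1 !mxE mulrA.
pose c l := (bezq A B)`_i`_l.
rewrite [RHS]mxE -[LHS]/(c j) -(@sum_delta_nat _ n c j); last first.
  by move=> l nl; rewrite /c (bezq_coef_out sA' sB') // nl orbT.
apply: eq_bigr => l _; rewrite [in RHS]mxE [E l j]mxE; congr (_ * _).
pose c' m := (bezq A B)`_m`_l.
rewrite /c -[LHS]/(c' i) -(@sum_delta_nat _ n c' i); last first.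
  by move=> m nm; rewrite /c' (bezq_coef_out sA' sB') // nm.
by apply: eq_bigr => m _; rewrite !mxE mulrC.
Qed.

(** * The Bezout map on homotopy classes: surjectivity and injectivity *)

Lemma naiveF_bez (k : fieldType) n x y : @naiveF k n x y ->
  naiveS n (bezmx n x.1 x.2) (bezmx n y.1 y.2).
Proof.
apply: (@rst_congr _ _ _ _ (fun f => bezmx n f.1 f.2)) => {x y} x y [H [r <- <-]].
exists (bezmx n H.1 H.2); split; first exact: bezmx_symnd.
- exact: (bezmx_map (horner_eval 0)).
- exact: (bezmx_map (horner_eval 1)).
Qed.

Lemma naiveS_stepF (k : fieldType) n (u : k) (f : {poly k} * {poly k}) :
  u != 0 -> ratfun_pt n f.1 f.2 ->
  naiveS n.+1 (bezmx n.+1 (stepF u f).1 (stepF u f).2)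
    (block_mx (u%:M : 'M_1) 0 0 (bezmx n f.1 f.2)).
Proof.
case: f => A B u0 r; have [g [dg ->]] := bezmx_stepF u0 r.
apply: rst_sym; apply: rst_step; apply: htpS_cg => //.
apply: (@symnd_diag _ 1 n); last exact: bezmx_symnd.
by split; [exact: tr_scalar_mx | rewrite det_scalar1 unitfE].
Qed.

Lemma dec_sumF (k : fieldType) (us : seq k) : all (fun u => u != 0) us ->
  dec (bezmx (size us) (sumF us).1 (sumF us).2) us.
Proof.
elim: us => [//|u us IH] /andP[u0 az].
have [g [dg]] := bezmx_stepF u0 (ratfun_sumF az); rewrite -surjective_pairing => E.
change (dec (bezmx (size us).+1 (stepF u (sumF us)).1 (stepF u (sumF us)).2) (u :: us)).
by rewrite E; apply: (@dec_cg _ (size us).+1) => //; apply: dec_block_line => //; exact: IH.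
Qed.

Lemma symnd_line (k : fieldType) (u : k) : u != 0 -> symnd_pt (u%:M : 'M_1).
Proof. by move=> u0; split; [exact: tr_scalar_mx | rewrite det_scalar1 unitfE]. Qed.

Lemma dec_naiveS (k : fieldType) n (M : 'M[k]_n) us : symnd_pt M -> dec M us ->
  naiveS n (bezmx n (sumF us).1 (sumF us).2) M.
Proof.
elim/ltn_ind: n M us => -[|n] IH M us sM.
  by move=> _; rewrite [bezmx _ _ _]flatmx0 [M]flatmx0; exact: rst_refl.
have line m (N : 'M[k]_m) u vs : (m < n.+1)%N -> u != 0 -> symnd_pt N -> dec N vs ->
    naiveS m.+1 (bezmx m.+1 (sumF (u :: vs)).1 (sumF (u :: vs)).2)
      (block_mx (u%:M : 'M_1) 0 0 N).
  move=> lm u0 sN dN; have [az sz] := dec_nz dN.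
  apply: rst_trans (naiveS_stepF u0 _) _; first by rewrite -[X in ratfun_pt X]sz; exact: ratfun_sumF.
  by apply: (@naiveS_diagl _ 1 m); [exact: symnd_line | exact: IH].
case=> [[g [u [N [us' [dg u0 E dN ->]]]]]|].
  have sN : symnd_pt N.
    by apply: (@symnd_block _ 1 n u%:M); rewrite -E; apply: symnd_cg.
  apply: rst_trans (line _ N _ _ _ u0 sN dN) _ => //.
  by rewrite -E; apply: rst_sym; apply: rst_step; apply: htpS_cg.
case: n IH M sM line => [//|n] IH M sM line [g [c [p [N [us' [dg c0 E dN ->]]]]]].
have sN : symnd_pt N.
  by apply: (@symnd_block _ 2 n (mat2 0 c c p)); rewrite -E; apply: symnd_cg.
have c20 : - c ^+ 2 != 0 by rewrite oppr_eq0 expf_neq0.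
have [az sz] := dec_nz dN.
have L := line n N (- c ^+ 2) us' (leqW (leqnn _)) c20 sN dN.
have rz : ratfun_pt n.+1 (sumF (- c ^+ 2 :: us')).1 (sumF (- c ^+ 2 :: us')).2.
  by rewrite -sz; apply: (@ratfun_sumF _ (- c ^+ 2 :: us')); rewrite /= c20.
apply: rst_trans (naiveS_stepF (oner_neq0 k) rz) _.
apply: rst_trans (@naiveS_diagl _ 1 n.+1 _ _ _ (symnd_line (oner_neq0 k)) L) _.
apply: (@rst_trans _ _ _ (block_mx (mat2 0 c c p) 0 0 N)); last first.
  by rewrite -E; apply: rst_sym; apply: rst_step; apply: htpS_cg.
rewrite block_112; apply: (@naiveS_diagr _ 2 n) => //.
(* A quarter turn exchanges the two lines with determinant 1, a plain transposition having
   determinant -1. *)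
pose g' := mat2 0 (-1) 1 0 : 'M[k]_2.
have -> : mat2 1 0 0 (- c ^+ 2) = cg g' (mat2 (- c ^+ 2) 0 0 1).
  by rewrite /cg tr_mat2 !mul_mat2; congr mat2; ring.
have sD : symnd_pt (mat2 (- c ^+ 2) 0 0 1) by apply: symnd_mat2; rewrite mulr1 mulr0 subr0.
apply: (@rst_trans _ _ _ (mat2 (- c ^+ 2) 0 0 1)).
  by apply: rst_sym; apply: rst_step; apply: htpS_cg => //; rewrite det_mat2; ring.
apply: (@rst_trans _ _ _ (mat2 0 c c 1)); last exact: naiveS_plane.
by apply: rst_sym; have := naiveS_plane_diag c0 (oner_neq0 k); rewrite divr1.
Qed.

(** The two ends of an elementary homotopy share a splitting by [dec_htp], and any other splitting
    of either end is compared with it by [dec_unique]. Both directions are stated so that the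
    induction passes through symmetry. *)
Lemma naiveS_dec (k : fieldType) n (M N : 'M[k]_n) : naiveS n M N ->
  (forall us, dec M us -> exists2 vs, dec N vs & leqs us vs) /\
  (forall vs, dec N vs -> exists2 us, dec M us & leqs us vs).
Proof.
elim=> {M N} [x y [H [sH Hx Hy]]|x|x y _ [I1 I2]|x y z _ [I1 I2] _ [J1 J2]].
- have [us dus] := dec_htp sH.
  have dx : dec x us by rewrite -Hx.
  have dy : dec y us by rewrite -Hy.
  have sx : symnd_pt x by rewrite -Hx; exact: (symnd_map (horner_eval 0)).
  have sy : symnd_pt y by rewrite -Hy; exact: (symnd_map (horner_eval 1)).
  by split=> vs d; exists us => //; [exact: dec_unique sx d dx | exact: dec_unique sy dy d].
- by split=> us d; exists us => //; exact: leqs_refl.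
- split=> us d.
    by have [vs dv L] := I2 us d; exists vs => //; exact: leqs_sym.
  by have [vs dv L] := I1 us d; exists vs => //; exact: leqs_sym.
- split=> us d.
    have [vs dv L] := I1 us d; have [ws dw L'] := J1 vs dv.
    by exists ws => //; exact: leqs_trans L L'.
  have [vs dv L] := J2 us d; have [ws dw L'] := I2 vs dv.
  by exists ws => //; exact: leqs_trans L' L.
Qed.

(** With both functions written as sums, the splitting of the first Bezout form is carried along the
    homotopy to the second one, compared there by [dec_unique] with the splitting of that form, and
    [leqs_sound] returns to functions. *)
Lemma bez_injective (k : fieldType) n (A1 B1 A2 B2 : {poly k}) :
  ratfun_pt n A1 B1 -> ratfun_pt n A2 B2 ->
  naiveS n (bezmx n A1 B1) (bezmx n A2 B2) -> naiveF n (A1, B1) (A2, B2).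
Proof.
move=> r1 r2 h; have [us [au su hu]] := ratfun_sumF_rep r1.
have [vs [av sv hv]] := ratfun_sumF_rep r2.
have hS : naiveS n (bezmx n (sumF us).1 (sumF us).2) (bezmx n (sumF vs).1 (sumF vs).2).
  apply: (@rst_trans _ _ _ (bezmx n A1 B1)); first exact/rst_sym/(naiveF_bez hu).
  by apply: rst_trans h _; exact: (naiveF_bez hv).
have du : dec (bezmx n (sumF us).1 (sumF us).2) us by rewrite -su; exact: dec_sumF.
have [ws dw L] := (naiveS_dec hS).1 us du.
have svs : symnd_pt (bezmx n (sumF vs).1 (sumF vs).2).
  by rewrite -sv; apply/bezmx_symnd/ratfun_sumF.
have dv : dec (bezmx n (sumF vs).1 (sumF vs).2) vs by rewrite -sv; exact: dec_sumF.
have [_ _ /(_ au)] := leqs_sound (leqs_trans L (dec_unique svs dw dv)); rewrite su => huv.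
apply: rst_trans hu _; apply: rst_trans huv _; exact: rst_sym.
Qed.

(** * Additivity and the final statement *)

Lemma oplusN_htp (k : fieldType) n1 n2 x y (A B : {poly k}) :
  ratfun_pt n2 A B -> htpF n1 x y ->
  htpF (n1 + n2) (oplusN n1 x.1 x.2 A B) (oplusN n1 y.1 y.2 A B).
Proof.
move=> r2 [H [r Hx Hy]]; have [U [V b]] := ratfun_bezout r; have [e sU sV] := b.
have [mA sA sB _] := r.
have sU' : (size U <= n1.+1)%N by apply: leq_trans sU _; case: (n1) => // m; rewrite /= !leqW.
have h : htpF (n1 + n2) _ _ := htp_oplus mA sA sB e sU' sV r2.
have E t : oplusN n1 (evP t H.1) (evP t H.2) A B =
    (evP t H.1 * A - evP t V * B, evP t H.2 * A + evP t U * B).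
  rewrite /oplusN; have [mAt sAt _ _] := ratfun_map (horner_eval t) r.
  (* By uniqueness, the coefficients chosen at each t are the values at t of those of the family. *)
  by rewrite (bez_UVP mAt sAt (bezout_rel_map (horner_eval t) b)).
by rewrite -Hx -Hy /= !E.
Qed.

(** An associativity statement, obtained by following the normalised Bezout coefficients of
    [sumF us] through each step, since [oplusN] is computed from them. *)
Lemma oplusN_sumF (k : fieldType) (us : seq k) (f : {poly k} * {poly k}) :
  all (fun u => u != 0) us ->
  oplusN (size us) (sumF us).1 (sumF us).2 f.1 f.2 = foldr (@stepF k) f us.
Proof.
move=> au; suff [U [V [b E]]] : exists U V,
    bezout_rel (size us) (sumF us).1 (sumF us).2 U V /\
    ((sumF us).1 * f.1 - V * f.2, (sumF us).2 * f.1 + U * f.2) = foldr (@stepF k) f us.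
  rewrite /oplusN; have [mA sA _ _] := ratfun_sumF au.
  by rewrite (bez_UVP mA sA b).
elim: us au => [_|u us IH] /=.
  exists 1, 0; rewrite mul0r subr0 mul1r mul0r add0r mul1r; split; last by case: f.
  by split; rewrite ?mulr1 ?mulr0 ?addr0 ?size_poly1 ?size_poly0.
case/andP=> u0 /IH [U [V [b <-]]]; have uu : u \is a GRing.unit by rewrite unitfE.
exists (- (u *: V)), ('X * V + u^-1 *: U); split.
  by have := bezout_stepF uu b; rewrite /stepF.
by rewrite /stepF /= -!mul_polyC; congr pair; ring.
Qed.

Lemma foldr_stepF_ratfun (k : fieldType) n (us : seq k) f :
  all (fun u => u != 0) us -> ratfun_pt n f.1 f.2 ->
  ratfun_pt (size us + n) (foldr (@stepF k) f us).1 (foldr (@stepF k) f us).2.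
Proof.
move=> + r; elim: us => [//|u us IH] /= /andP[u0 /IH h].
by apply: ratfun_stepF => //; rewrite unitfE.
Qed.

Lemma bez_foldr_stepF (k : fieldType) n (us : seq k) f :
  all (fun u => u != 0) us -> ratfun_pt n f.1 f.2 ->
  naiveS (size us + n)
    (bezmx (size us + n) (foldr (@stepF k) f us).1 (foldr (@stepF k) f us).2)
    (osum (bezmx (size us) (sumF us).1 (sumF us).2) (bezmx n f.1 f.2)).
Proof.
move=> + r; elim: us => [_|u us IH] /=.
  have -> : osum (bezmx 0 1 0) (bezmx n f.1 f.2) = bezmx n f.1 f.2; last exact: rst_refl.
  apply/matrixP=> i j; rewrite /osum.
  have e (l : 'I_n) : rshift 0 l = l :> 'I_(0 + n) by exact: val_inj.
  by rewrite -[in LHS](e i) -[in LHS](e j) block_mxEdr.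
case/andP=> u0 az; have sf := bezmx_symnd r.
apply: rst_trans (naiveS_stepF u0 (foldr_stepF_ratfun az r)) _.
apply: rst_trans (@naiveS_diagl _ 1 _ _ _ _ (symnd_line u0) (IH az)) _.
have := block_diagA (u%:M : 'M_1) (bezmx (size us) (sumF us).1 (sumF us).2) (bezmx n f.1 f.2).
rewrite castmx_id => ->.
apply: (@naiveS_diagr _ (1 + size us) n) => //.
apply: rst_sym; exact: naiveS_stepF u0 (ratfun_sumF az).
Qed.

Theorem theorem3p7 (k : fieldType) :
  (* well defined and injective on each graded piece *)
  (forall (n : nat) (A1 B1 A2 B2 : {poly k}),
     ratfun_pt n A1 B1 -> ratfun_pt n A2 B2 ->
     (naiveF n (A1, B1) (A2, B2) <->
      naiveS n (Bez_mx n A1 B1) (Bez_mx n A2 B2))) /\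
  (* surjective on each graded piece *)
  (forall (n : nat) (M : 'M[k]_n), symnd_pt M ->
     exists A B : {poly k}, ratfun_pt n A B /\ naiveS n (Bez_mx n A B) M) /\
  (* morphism of monoids *)
  (forall (n1 n2 : nat) (A1 B1 A2 B2 : {poly k}),
     ratfun_pt n1 A1 B1 -> ratfun_pt n2 A2 B2 ->
     naiveS (n1 + n2)
       (Bez_mx (n1 + n2) (oplusN n1 A1 B1 A2 B2).1 (oplusN n1 A1 B1 A2 B2).2)
       (osum (Bez_mx n1 A1 B1) (Bez_mx n2 A2 B2))).
Proof.
split; [|split].
- move=> n A1 B1 A2 B2 r1 r2; rewrite !Bez_mxE.
  by split; [exact: naiveF_bez | exact: bez_injective].
- move=> n M sM; have [us d] := dec_exists sM; have [au su] := dec_nz d.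
  exists (sumF us).1, (sumF us).2; split; first by rewrite -su; exact: ratfun_sumF.
  by rewrite Bez_mxE; exact: dec_naiveS.
- move=> n1 n2 A1 B1 A2 B2 r1 r2; rewrite !Bez_mxE.
  (* Only the first summand has to be replaced by a sum of X / u; the second is kept as it is. *)
  have [us [au su hu]] := ratfun_sumF_rep r1; rewrite -su in r1 hu *.
  have hO : naiveF (size us + n2) (oplusN (size us) A1 B1 A2 B2)
      (foldr (@stepF k) (A2, B2) us).
    rewrite -oplusN_sumF //.
    apply: (@rst_congr _ _ _ _ (fun x => oplusN (size us) x.1 x.2 A2 B2) _ (A1, B1)) hu.
    by move=> x y; exact: oplusN_htp.
  apply: rst_trans (naiveF_bez hO) _.
  apply: rst_trans (bez_foldr_stepF au (r2 : ratfun_pt n2 (A2, B2).1 (A2, B2).2)) _.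
  apply: (@naiveS_diagr _ (size us) n2); first exact: bezmx_symnd.
  exact/rst_sym/(naiveF_bez hu).
Qed.
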